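(* Let $p$ be a prime, $S$ a finite $p$-group, $\mathcal{F}$ a saturated fusion system over $S$, and let $n$ denote the cardinality of $Cl(\mathcal{F})$. For a prime ideal $\mathcal{I}$ of $A(\mathcal{F})$, call the characteristic of $A(\mathcal{F})/\mathcal{I}$ (which is $0$ or a prime) the type of $\mathcal{I}$. The prime ideals of $A(\mathcal{F})$ are the following: - Type $p$. There is only one prime ideal of type $p$, which is $$\mathcal{I}_{S,p} = \{ X \in A(\mathcal{F}) \mid \Phi_S(X) \equiv 0 \bmod p \} = \big\langle \{\alpha_{[P]_{\mathcal{F}}} \mid P<S \}\cup \{p \cdot \alpha_{[S]_{\mathcal{F}}} \} \big\rangle .$$ - Type $0$. There are exactly $n$ prime ideals of type $0$, one per class $[P]_{\mathcal{F}} \in Cl(\mathcal{F})$ (distinct classes giving distinct ideals, and the ideal depending only on the class): $$\mathcal{I}_{P,0} = \{ X \in A(\mathcal{F}) \mid \Phi_P(X) =0 \} = \big\langle \big\{ \alpha_{[Q]_{\mathcal{F}}} - \Phi_P( \alpha_{[Q]_{\mathcal{F}}}) \cdot \alpha_{[S]_{\mathcal{F}}} \mid Q<S \big\} \big\rangle .$$ - Type $q$, for each prime $q \neq p$. There are exactly $n$ prime ideals of type $q$, one per class $[P]_{\mathcal{F}} \in Cl(\mathcal{F})$ (distinct classes giving distinct ideals, and the ideal depending only on the class): $$\mathcal{I}_{P,q} = \{ X \in A(\mathcal{F}) \mid \Phi_P(X) \equiv 0 \bmod q \} .$$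
   Context: Fusion systems. Let $p$ be a prime and $S$ a finite $p$-group. A fusion system $\mathcal{F}$ over $S$ is a category whose objects are the subgroups of $S$ and whose morphism sets $\mathcal{F}(P,Q)$ satisfy: (i) every morphism in $\mathcal{F}(P,Q)$ is an injective group homomorphism $P\to Q$; (ii) for every $s\in S$ with $sPs^{-1}\leq Q$, the map $P\to Q$, $x\mapsto sxs^{-1}$ belongs to $\mathcal{F}(P,Q)$; (iii) if $\varphi\in\mathcal{F}(P,Q)$ then $\varphi:P\to\varphi(P)$ and $\varphi^{-1}:\varphi(P)\to P$ are morphisms of $\mathcal{F}$. Subgroups $P,Q$ are $\mathcal{F}$-isomorphic ($P\sim_{\mathcal{F}}Q$) if they are isomorphic in $\mathcal{F}$; $[P]_{\mathcal{F}}$ is the class of $P$ and $Cl(\mathcal{F})$ the set of classes. $P\lesssim_{\mathcal{F}}Q$ means $\mathcal{F}(P,Q)\neq\emptyset$; this induces a partial order on $Cl(\mathcal{F})$. $\mathcal{F}$ is saturated if each class in $Cl(\mathcal{F})$ contains a subgroup $P$ such that: $\mathrm{Aut}_S(P)$ (automorphisms of $P$ induced by conjugation by elements of $N_S(P)$) is a Sylow $p$-subgroup of $\mathrm{Aut}_{\mathcal{F}}(P)=\mathcal{F}(P,P)$; and, for each $Q\leq S$ and each isomorphism $\varphi:Q\to P$ in $\mathcal{F}$, $\varphi$ extends to a morphism in $\mathcal{F}(N_\varphi,S)$, where $N_\varphi=\{g\in N_S(Q)\mid \varphi c_g\varphi^{-1}\in \mathrm{Aut}_S(P)\}$ and $c_g(x)=gxg^{-1}$.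 Burnside rings. $A_+(S)$ is the semiring of isomorphism classes of finite $S$-sets (disjoint union and cartesian product), and the Burnside ring $A(S)$ is its Grothendieck ring; it is free over $\mathbb{Z}$ on the classes $[S/P]$, one per $S$-conjugacy class of subgroups. For $P\leq S$, $\Phi_P:A(S)\to\mathbb{Z}$ is the ring homomorphism with $\Phi_P([X])=|X^P|$ (number of $P$-fixed points) for each finite $S$-set $X$. An element $X\in A(S)$ is $\mathcal{F}$-stable if for every $P\leq S$ and $\varphi\in\mathcal{F}(P,S)$ the restrictions of $X$ to $A(P)$ along $\varphi$ and along the inclusion $P\hookrightarrow S$ coincide; equivalently $\Phi_P(X)=\Phi_Q(X)$ whenever $P\sim_{\mathcal{F}}Q$. The $\mathcal{F}$-stable elements form a subring $A(\mathcal{F})$ of $A(S)$, the Burnside ring of $\mathcal{F}$. Basis (known result of Reeh for saturated $\mathcal{F}$). There are $\mathcal{F}$-stable elements $\alpha_{[P]_{\mathcal{F}}}\in A_+(S)$, one per class $[P]_{\mathcal{F}}\in Cl(\mathcal{F})$, forming a $\mathbb{Z}$-basis of $A(\mathcal{F})$, such that: (i) $\alpha_{[P]_{\mathcal{F}}}$ is a linear combination of the $[S/P']$ with $P'\lesssim_{\mathcal{F}}P$; (ii) for every $P_0\in[P]_{\mathcal{F}}$ with $|N_S(P_0)|$ maximal among members of $[P]_{\mathcal{F}}$, the coefficient of $[S/P_0]$ in $\alpha_{[P]_{\mathcal{F}}}$ is $1$, and its coefficient in $\alpha_{[Q]_{\mathcal{F}}}$ is $0$ for $[Q]_{\mathcal{F}}\neq[P]_{\mathcal{F}}$;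 (iii) for such $P_0$, $\Phi_{P_0}(\alpha_{[P]_{\mathcal{F}}})=|N_S(P_0)|/|P_0|$; (iv) $\Phi_Q(\alpha_{[P]_{\mathcal{F}}})\neq0$ if and only if $Q\lesssim_{\mathcal{F}}P$. In particular $\alpha_{[S]_{\mathcal{F}}}=[S/S]$ is the unit. $\langle\cdot\rangle$ denotes the ideal of $A(\mathcal{F})$ generated by a set; $P<S$ means $P$ is a proper subgroup of $S$. *)

(* Defs.v *)
From HB Require Import structures.
From mathcomp Require Import all_boot all_order all_algebra all_fingroup.
From mathcomp Require Import pgroup ring.
From mathcomp Require Import boolp classical_sets functions cardinality.

Set Implicit Arguments.
Unset Strict Implicit.
Unset Printing Implicit Defensive.

Import GroupScope GRing.Theory Num.Theory.

Section FusionSystems.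

Variable gT : finGroupType.
Implicit Types (S P Q R : {group gT}) (f g : gT -> gT).

(** A morphism from P to Q is represented by any total function on gT
    restricting to it, so that [fhom] is invariant under change of the
    function outside P ([fhom_ext]).  Since [x ^ s = s^-1 * x * s], the
    conjugation map [x |-> s x s^-1] is [conjg^~ s^-1]; the axiom [fhom_conj]
    is quantified over all s in S. *)
Record fusion_system S := FusionSystem {
  fhom : {group gT} -> {group gT} -> pred (gT -> gT);
  fhom_obj : forall P Q f, fhom P Q f -> P \subset S /\ Q \subset S;
  fhom_ext : forall P Q f g, {in P, f =1 g} -> fhom P Q f -> fhom P Q g;
  fhom_comp : forall P Q R f g,
    fhom P Q f -> fhom Q R g -> fhom P R (g \o f);
  fhom_injmorph : forall P Q f, fhom P Q f ->
    [/\ {in P &, {morph f : x y / x * y}}, {in P &, injective f}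
      & f @: P \subset Q];
  fhom_conj : forall P Q s, P \subset S -> Q \subset S -> s \in S ->
    P :^ s \subset Q -> fhom P Q (conjg^~ s);
  fhom_corestr : forall P Q R f,
    fhom P Q f -> f @: P = R :> {set gT} -> fhom P R f;
  fhom_inv : forall P Q R f g,
    fhom P Q f -> f @: P = R :> {set gT} -> {in P, cancel f g} -> fhom R P g
}.

Variables (S0 : {group gT}) (F : fusion_system S0).

Definition fisom P Q f :=
  fhom F P Q f &&
  [exists g : {ffun gT -> gT},
     [&& fhom F Q P g, [forall x in P, g (f x) == x]
       & [forall y in Q, f (g y) == y]]].

Definition fconj P Q := [exists f : {ffun gT -> gT}, fisom P Q f].

Definition flesssim P Q := [exists f : {ffun gT -> gT}, fhom F P Q f].

Definition fclass P : {set {group gT}} := [set Q in subgroups S0 | fconj P Q].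

Definition Cl : {set {set {group gT}}} := fclass @: subgroups S0.

Definition AutF P : {set {perm gT}} := [set a in Aut P | fhom F P P a].

Definition AutS P : {set {perm gT}} := conj_aut P @* 'N_S0(P).

(** [N_phi], for an isomorphism [f : Q -> P]; the condition
    [f c_z f^-1 \in Aut_S(P)] is written [f c_z = a f] on Q, with
    [a \in Aut_S(P)]. *)
Definition Nphi P Q f : {set gT} :=
  [set z in 'N_S0(Q) | [exists a in AutS P,
                         [forall x in Q, f (x ^ z) == a (f x)]]].

Lemma group_set_Nphi P Q f : group_set (Nphi P Q f).
Proof.
apply/group_setP; split.
  apply/setIdP; split; first exact: group1.
  apply/exists_inP; exists 1; first exact: (group1 (conj_aut P @* 'N_S0(P))).
  by apply/forall_inP=> x _; rewrite conjg1 perm1.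
move=> x y /setIdP[Nx /exists_inP[a Aa /forall_inP ha]].
case/setIdP=> Ny /exists_inP[b Ab /forall_inP hb].
apply/setIdP; split; first exact: groupM.
apply/exists_inP; exists (a * b).
  exact: (groupM (G := (conj_aut P @* 'N_S0(P))%G)).
apply/forall_inP=> z Qz; rewrite conjgM permM.
have Nx' : x \in 'N(Q) by case/setIP: Nx.
by rewrite (eqP (hb _ _)) ?memJ_norm // (eqP (ha z Qz)).
Qed.

Canonical Nphi_group P Q f := Group (group_set_Nphi P Q f).

Definition saturated (p : nat) : Prop :=
  forall C, C \in Cl -> exists2 P, P \in C &
    p.-Sylow(AutF P) (AutS P) /\
    forall Q f, Q \subset S0 -> fisom Q P f ->
      exists2 h, fhom F (Nphi_group P Q f) S0 h & {in Q, f =1 h}.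

Lemma group_set_AutF P : P \subset S0 -> group_set (AutF P).
Proof.
move=> PS; apply/group_setP; split.
  apply/setIdP; split; first exact: (group1 [group of Aut P]).
  apply: fhom_ext (fhom_conj F PS PS (group1 S0) _); last by rewrite conjsg1.
  by move=> x _; rewrite /= conjg1 perm1.
move=> a b /setIdP[Aa ha] /setIdP[Ab hb]; apply/setIdP; split.
  exact: (groupM (G := [group of Aut P])).
by apply: fhom_ext (fhom_comp ha hb) => x _; rewrite /= permM.
Qed.

End FusionSystems.

(** The library's actions are right actions, a left action of g being the
    right action of [g^-1]. *)

Section GSets.

Variables (gT : finGroupType) (G : {group gT}).

Record gset := Gset { gset_sort :> finType; gset_act : action G gset_sort }.

Definition gset_iso (X Y : gset) : Prop :=
  exists2 f : X -> Y, bijective f &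
    forall x g, g \in G -> f (gset_act X x g) = gset_act Y (f x) g.

Lemma gset_iso_refl X : gset_iso X X.
Proof. by exists id => //; exists id. Qed.

Lemma gset_iso_sym X Y : gset_iso X Y -> gset_iso Y X.
Proof.
case=> f [f' fK f'K] hf; exists f'; first by exists f.
by move=> y g Gg; rewrite -{1}[y]f'K -hf // fK.
Qed.

Lemma gset_iso_trans Y X Z : gset_iso X Y -> gset_iso Y Z -> gset_iso X Z.
Proof.
case=> f bf hf [h bh hh]; exists (h \o f); first exact: bij_comp.
by move=> x g Gg /=; rewrite hf // hh.
Qed.

Section Trivial.
Variable T : finType.
Definition triv_act (x : T) (_ : gT) := x.
Lemma triv_is_action : is_action G triv_act.
Proof. by split=> //; move=> a x y. Qed.
Definition triv_gset := Gset (Action triv_is_action).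
End Trivial.

Section SumProd.
Variables X Y : gset.

Definition sum_act (u : X + Y) (g : gT) : X + Y :=
  match u with
  | inl x => inl (gset_act X x g)
  | inr y => inr (gset_act Y y g)
  end.

Lemma sum_is_action : is_action G sum_act.
Proof.
split=> [g [x|y] [x'|y'] //= []|[x|y] g h Gg Gh] /=.
- by move/act_inj->.
- by move/act_inj->.
- by rewrite actMin.
- by rewrite actMin.
Qed.

Definition sum_gset := Gset (Action sum_is_action).

Definition prod_act (u : X * Y) (g : gT) : X * Y :=
  (gset_act X u.1 g, gset_act Y u.2 g).

Lemma prod_is_action : is_action G prod_act.
Proof.
split=> [g [x y] [x' y'] /= []|[x y] g h Gg Gh]; rewrite /prod_act /=.
  by move=> /act_inj-> /act_inj->.
by rewrite !actMin.
Qed.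

Definition prod_gset := Gset (Action prod_is_action).

End SumProd.

(** The transitive G-set of (right) cosets of H in G. *)
Section Cosets.
Variable H : {group gT}.
Let cosets := {A : {set gT} | A \in rcosets H G}.

Lemma sub_coset_dom : G \subset subact_dom (mem (rcosets H G)) 'Rs.
Proof.
rewrite /subact_dom; set D := finset _.
suff -> : D = rcosets H G by exact: actsRs_rcosets.
by apply/setP=> A; rewrite inE.
Qed.

Definition coset_gset := Gset (('Rs^? : action _ cosets) \ sub_coset_dom)%act.

End Cosets.

End GSets.

(** Every finite G-set is isomorphic to one carried by some ['I_n]; the latter
    form a small type, of which A_+(G) is the quotient by isomorphism. *)

Section BurnsideSemiring.

Variables (gT : finGroupType) (G : {group gT}).

Record ord_gset := OrdGset { ord_deg : nat; ord_act : action G 'I_ord_deg }.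

HB.instance Definition _ := gen_eqMixin ord_gset.
HB.instance Definition _ := gen_choiceMixin ord_gset.

Definition gset_of (X : ord_gset) : gset G := Gset (ord_act X).

Section Encode.
Variable X : gset G.

Definition encode_act (i : 'I_#|X|) (g : gT) : 'I_#|X| :=
  enum_rank (gset_act X (enum_val i) g).

Lemma encode_is_action : is_action G encode_act.
Proof.
split=> [g i j /enum_rank_inj/act_inj/enum_val_inj //|i g h Gg Gh].
by rewrite /encode_act enum_rankK actMin.
Qed.

Definition encode := OrdGset (Action encode_is_action).

Lemma encode_iso : gset_iso (gset_of encode) X.
Proof.
exists (@enum_val X predT); first exact: enum_val_bij.
by move=> i g _; rewrite /= /encode_act enum_rankK.
Qed.

End Encode.

Definition ord_iso (X Y : ord_gset) : bool :=
  `[< gset_iso (gset_of X) (gset_of Y) >].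

Lemma ord_iso_equiv : equiv_class_of ord_iso.
Proof.
split=> [X|X Y|Y X Z].
- exact/asboolP/gset_iso_refl.
- by apply/asboolP/asboolP; apply: gset_iso_sym.
- move=> /asboolP XY /asboolP YZ; apply/asboolP; exact: gset_iso_trans XY YZ.
Qed.

Canonical ord_iso_equivRel := EquivRelPack ord_iso_equiv.
Canonical ord_iso_encModRel := defaultEncModRel ord_iso.

Definition gclasses := {eq_quot ord_iso}%qT.

HB.instance Definition _ := Choice.on gclasses.

Definition gclass (X : gset G) : gclasses := \pi_gclasses%qT (encode X).

Definition grepr (x : gclasses) : gset G := gset_of (generic_quotient.repr x).

Lemma eq_gclass X Y : gset_iso X Y <-> gclass X = gclass Y.
Proof.
have enc Z := encode_iso Z; split.
  move=> XY; apply/eqmodP/asboolP.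
  apply: gset_iso_trans (gset_iso_trans (enc X) XY) _.
  exact/gset_iso_sym/enc.
move=> /eqmodP/asboolP XY; apply: gset_iso_trans (gset_iso_sym (enc X)) _.
exact: gset_iso_trans XY (enc Y).
Qed.

Lemma greprK x : gclass (grepr x) = x.
Proof.
rewrite -[RHS]reprK; apply/eqmodP/asboolP; exact: encode_iso.
Qed.

Lemma gclassK X : gset_iso (grepr (gclass X)) X.
Proof. by apply/eq_gclass; rewrite greprK. Qed.

Lemma gclassP x : exists X, x = gclass X.
Proof. by exists (grepr x); rewrite greprK. Qed.

Definition gclass0 := gclass (triv_gset G void).
Definition gclass1 := gclass (triv_gset G unit).
Definition gclass_add x y := gclass (sum_gset (grepr x) (grepr y)).
Definition gclass_mul x y := gclass (prod_gset (grepr x) (grepr y)).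

Lemma sum_gset_iso X X' Y Y' : gset_iso X X' -> gset_iso Y Y' ->
  gset_iso (@sum_gset _ G X Y) (sum_gset X' Y').
Proof.
case=> f [f' fK f'K] hf [h [h' hK h'K] hh].
exists (fun u => match u with inl x => inl (f x) | inr y => inr (h y) end).
  exists (fun u => match u with inl x => inl (f' x) | inr y => inr (h' y) end).
    by case=> x; rewrite ?fK ?hK.
  by case=> x; rewrite ?f'K ?h'K.
by case=> x g Gg /=; rewrite ?hf ?hh.
Qed.

Lemma prod_gset_iso X X' Y Y' : gset_iso X X' -> gset_iso Y Y' ->
  gset_iso (@prod_gset _ G X Y) (prod_gset X' Y').
Proof.
case=> f [f' fK f'K] hf [h [h' hK h'K] hh].
exists (fun u => (f u.1, h u.2)).
  exists (fun u => (f' u.1, h' u.2)).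
    by case=> x y /=; rewrite fK hK.
  by case=> x y /=; rewrite f'K h'K.
by case=> x y g Gg; rewrite /= /prod_act /= hf // hh.
Qed.

Lemma gclass_addE X Y :
  gclass_add (gclass X) (gclass Y) = gclass (sum_gset X Y).
Proof. by apply/eq_gclass/sum_gset_iso; apply: gclassK. Qed.

Lemma gclass_mulE X Y :
  gclass_mul (gclass X) (gclass Y) = gclass (prod_gset X Y).
Proof. by apply/eq_gclass/prod_gset_iso; apply: gclassK. Qed.

Lemma gclass_addA : associative gclass_add.
Proof.
move=> x y z; have [[X ->] [Y ->] [Z ->]] := And3 (gclassP x) (gclassP y) (gclassP z).
rewrite !gclass_addE; apply/eq_gclass.
exists (fun u : X + (Y + Z) => match u : X + (Y + Z) with
  | inl x => inl (inl x) | inr (inl y) => inl (inr y) | inr (inr z) => inr z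
  end : (X + Y) + Z).
  exists (fun u : (X + Y) + Z => match u with
  | inl (inl x) => inl x | inl (inr y) => inr (inl y) | inr z => inr (inr z)
  end : X + (Y + Z)).
    by case=> [|[]].
  by case=> [[]|].
by case=> [|[]].
Qed.

Lemma gclass_addC : commutative gclass_add.
Proof.
move=> x y; have [[X ->] [Y ->]] := conj (gclassP x) (gclassP y).
rewrite !gclass_addE; apply/eq_gclass.
pose sw A B (u : A + B) := match u with inl x => inr x | inr y => inl y end.
by exists (@sw X Y); [exists (@sw Y X); case | case].
Qed.

Lemma gclass_add0 : left_id gclass0 gclass_add.
Proof.
move=> x; have [X ->] := gclassP x.
rewrite gclass_addE; apply/eq_gclass.
exists (fun u : void + X => match u with inl v => of_void X v | inr y => y end).
  by exists inr => // -[].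
by case.
Qed.

Lemma gclass_mulA : associative gclass_mul.
Proof.
move=> x y z; have [[X ->] [Y ->] [Z ->]] := And3 (gclassP x) (gclassP y) (gclassP z).
rewrite !gclass_mulE; apply/eq_gclass.
exists (fun u : X * (Y * Z) => ((u.1, u.2.1), u.2.2)) => //.
by exists (fun u : X * Y * Z => (u.1.1, (u.1.2, u.2))) => [[?[]]|[[]]].
Qed.

Lemma gclass_mulC : commutative gclass_mul.
Proof.
move=> x y; have [[X ->] [Y ->]] := conj (gclassP x) (gclassP y).
rewrite !gclass_mulE; apply/eq_gclass.
exists (fun u : X * Y => (u.2, u.1)) => //.
by exists (fun u : Y * X => (u.2, u.1)) => -[].
Qed.

Lemma gclass_mul1 : left_id gclass1 gclass_mul.
Proof.
move=> x; have [X ->] := gclassP x.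
rewrite gclass_mulE; apply/eq_gclass.
exists (fun u : unit * X => u.2) => //.
by exists (fun x => (tt, x)) => // -[[]].
Qed.

Lemma gclass_mulDl : left_distributive gclass_mul gclass_add.
Proof.
move=> x y z; have [[X ->] [Y ->] [Z ->]] := And3 (gclassP x) (gclassP y) (gclassP z).
rewrite !(gclass_mulE, gclass_addE); apply/eq_gclass.
exists (fun u : (X + Y) * Z => match u with
  | (inl x, z) => inl (x, z) | (inr y, z) => inr (y, z) end
  : (X * Z) + (Y * Z)).
  exists (fun u : (X * Z) + (Y * Z) => match u with
    | inl v => (inl v.1, v.2) | inr v => (inr v.1, v.2) end
    : (X + Y) * Z).
    by case=> [[?|?] ?].
  by case=> [[? ?]|[? ?]].
by case=> [[]].
Qed.

Lemma gclass_mul0 : left_zero gclass0 gclass_mul.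
Proof.
move=> x; have [X ->] := gclassP x.
rewrite gclass_mulE; apply/eq_gclass.
exists (fun u : void * X => u.1); last by case=> [[]].
by exists (fun v : void => (v, of_void X v)); [case=> [[]] | case].
Qed.

HB.instance Definition _ := GRing.isNmodule.Build gclasses
  gclass_addA gclass_addC gclass_add0.

HB.instance Definition _ := GRing.Nmodule_isComPzSemiRing.Build gclasses
  gclass_mulA gclass_mulC gclass_mul1 gclass_mulDl gclass_mul0.

Lemma gclass_sum X Y : gclass (sum_gset X Y) = (gclass X + gclass Y)%R.
Proof. by rewrite -gclass_addE. Qed.

Lemma gclass_prod X Y : gclass (prod_gset X Y) = (gclass X * gclass Y)%R.
Proof. by rewrite -gclass_mulE. Qed.

End BurnsideSemiring.

Section Grothendieck.

Local Open Scope ring_scope.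

Variable R : comPzSemiRingType.
Implicit Types (u v w : R * R).

(** The pair (a, b) represents the formal difference of a and b. *)
Definition groth_eqv u v : bool :=
  `[< exists k, u.1 + v.2 + k = v.1 + u.2 + k >].

Lemma groth_equiv : equiv_class_of groth_eqv.
Proof.
split=> [u|u v|v u w].
- by apply/asboolP; exists 0.
- by apply/asboolP/asboolP=> -[k e]; exists k.
move=> /asboolP[k e] /asboolP[l f]; apply/asboolP.
exists (v.1 + v.2 + k + l).
transitivity ((u.1 + v.2 + k) + (v.1 + w.2 + l)); first by ring.
by rewrite e f; ring.
Qed.

Canonical groth_equivRel := EquivRelPack groth_equiv.
Canonical groth_encModRel := defaultEncModRel groth_eqv.

Definition groth := {eq_quot groth_eqv}%qT.

HB.instance Definition _ := Choice.on groth.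

Definition gdiff u : groth := \pi_groth%qT u.

Definition groth_of (a : R) : groth := gdiff (a, 0).

Lemma eq_gdiff u v :
  gdiff u = gdiff v <-> exists k, u.1 + v.2 + k = v.1 + u.2 + k.
Proof.
by split=> [/eqmodP/asboolP|h]; last by apply/eqmodP/asboolP.
Qed.

Lemma gdiffP (x : groth) : exists u, x = gdiff u.
Proof. by exists (generic_quotient.repr x); rewrite /gdiff reprK. Qed.

Lemma gdiff_repr (x : groth) : gdiff (generic_quotient.repr x) = x.
Proof. exact: reprK. Qed.

Definition gadd_pair u v := (u.1 + v.1, u.2 + v.2).
Definition gopp_pair u : R * R := (u.2, u.1).
Definition gmul_pair u v := (u.1 * v.1 + u.2 * v.2, u.1 * v.2 + u.2 * v.1).

Definition gadd (x y : groth) :=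
  gdiff (gadd_pair (generic_quotient.repr x) (generic_quotient.repr y)).
Definition gopp (x : groth) := gdiff (gopp_pair (generic_quotient.repr x)).
Definition gmul (x y : groth) :=
  gdiff (gmul_pair (generic_quotient.repr x) (generic_quotient.repr y)).

Lemma gaddE u v : gadd (gdiff u) (gdiff v) = gdiff (gadd_pair u v).
Proof.
rewrite /gadd; set u' := generic_quotient.repr _; set v' := generic_quotient.repr _.
have /eq_gdiff[k e] : gdiff u' = gdiff u by exact: gdiff_repr.
have /eq_gdiff[l f] : gdiff v' = gdiff v by exact: gdiff_repr.
apply/eq_gdiff; exists (k + l); rewrite /gadd_pair /=.
transitivity ((u'.1 + u.2 + k) + (v'.1 + v.2 + l)); first by ring.
by rewrite e f; ring.
Qed.

Lemma goppE u : gopp (gdiff u) = gdiff (gopp_pair u).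
Proof.
rewrite /gopp; set u' := generic_quotient.repr _.
have /eq_gdiff[k e] : gdiff u' = gdiff u by exact: gdiff_repr.
apply/eq_gdiff; exists k; rewrite /gopp_pair /=.
by rewrite addrC [u'.2 + _]addrC -addrC -e; ring.
Qed.

Lemma gmulE u v : gmul (gdiff u) (gdiff v) = gdiff (gmul_pair u v).
Proof.
rewrite /gmul; set u' := generic_quotient.repr _; set v' := generic_quotient.repr _.
have /eq_gdiff[k e] : gdiff u' = gdiff u by exact: gdiff_repr.
have /eq_gdiff[l f] : gdiff v' = gdiff v by exact: gdiff_repr.
transitivity (gdiff (gmul_pair u v')).
  apply/eq_gdiff; exists (k * v'.1 + k * v'.2); rewrite /gmul_pair /=.
  transitivity ((u'.1 + u.2 + k) * v'.1 + (u.1 + u'.2 + k) * v'.2).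
    by ring.
  by rewrite -e {1}e; ring.
apply/eq_gdiff; exists (u.1 * l + u.2 * l); rewrite /gmul_pair /=.
transitivity (u.1 * (v'.1 + v.2 + l) + u.2 * (v.1 + v'.2 + l)).
  by ring.
by rewrite -f {1}f; ring.
Qed.

Lemma gaddA : associative gadd.
Proof.
move=> x y z; have [[u ->] [v ->] [w ->]] := And3 (gdiffP x) (gdiffP y) (gdiffP z).
by rewrite !gaddE /gadd_pair /= !addrA.
Qed.

Lemma gaddC : commutative gadd.
Proof.
move=> x y; have [[u ->] [v ->]] := conj (gdiffP x) (gdiffP y).
by rewrite !gaddE /gadd_pair addrC [u.2 + _]addrC.
Qed.

Lemma gadd0 : left_id (gdiff (0, 0)) gadd.
Proof.
by move=> x; have [[a b] ->] := gdiffP x; rewrite gaddE /gadd_pair /= !add0r.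
Qed.

Lemma gaddN : left_inverse (gdiff (0, 0)) gopp gadd.
Proof.
move=> x; have [u ->] := gdiffP x; rewrite goppE gaddE.
by apply/eq_gdiff; exists 0; rewrite /gadd_pair /=; ring.
Qed.

Lemma gmulA : associative gmul.
Proof.
move=> x y z; have [[u ->] [v ->] [w ->]] := And3 (gdiffP x) (gdiffP y) (gdiffP z).
by rewrite !gmulE; congr gdiff; congr pair => /=; ring.
Qed.

Lemma gmulC : commutative gmul.
Proof.
move=> x y; have [[u ->] [v ->]] := conj (gdiffP x) (gdiffP y).
by rewrite !gmulE; congr gdiff; congr pair => /=; ring.
Qed.

Lemma gmul1 : left_id (gdiff (1, 0)) gmul.
Proof.
move=> x; have [[a b] ->] := gdiffP x.
by rewrite gmulE; congr gdiff; congr pair => /=; ring.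
Qed.

Lemma gmulDl : left_distributive gmul gadd.
Proof.
move=> x y z; have [[u ->] [v ->] [w ->]] := And3 (gdiffP x) (gdiffP y) (gdiffP z).
by rewrite !(gmulE, gaddE); congr gdiff; congr pair => /=; ring.
Qed.

HB.instance Definition _ := GRing.isZmodule.Build groth
  gaddA gaddC gadd0 gaddN.

HB.instance Definition _ := GRing.Zmodule_isComPzRing.Build groth
  gmulA gmulC gmul1 gmulDl.

Lemma gdiffE u : gdiff u = groth_of u.1 - groth_of u.2.
Proof.
rewrite -[RHS]/(gadd _ (gopp _)) goppE gaddE /gadd_pair /gopp_pair /=.
by rewrite addr0 add0r; case: u.
Qed.

Lemma groth_ofD a b : groth_of (a + b) = groth_of a + groth_of b.
Proof.
by rewrite -[RHS]/(gadd _ _) gaddE /gadd_pair /= addr0.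
Qed.

Lemma groth_ofM a b : groth_of (a * b) = groth_of a * groth_of b.
Proof.
rewrite -[RHS]/(gmul _ _) gmulE /groth_of; congr gdiff; congr pair => /=; ring.
Qed.

Lemma groth_of0 : groth_of 0 = 0. Proof. by []. Qed.
Lemma groth_of1 : groth_of 1 = 1. Proof. by []. Qed.

(** The extension to the Grothendieck ring of an additive map [f]. *)
Section Lift.

Variables (V : zmodType) (f : R -> V).

Definition groth_lift (x : groth) : V :=
  f (generic_quotient.repr x).1 - f (generic_quotient.repr x).2.

Hypothesis fD : {morph f : a b / a + b}.

Lemma groth_lift_diff u : groth_lift (gdiff u) = f u.1 - f u.2.
Proof.
rewrite /groth_lift; set u' := generic_quotient.repr _.
have /eq_gdiff[k e] : gdiff u' = gdiff u by exact: gdiff_repr.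
move/(congr1 f): e; rewrite !fD => /addIr e.
by apply/eqP; rewrite subr_eq addrAC eq_sym subr_eq eq_sym e.
Qed.

Lemma groth_liftE a : groth_lift (groth_of a) = f a.
Proof.
have f0 : f 0 = 0 by apply: (addrI (f 0)); rewrite -fD !addr0.
by rewrite groth_lift_diff /= f0 subr0.
Qed.

Lemma groth_liftB : {morph groth_lift : x y / x - y}.
Proof.
move=> x y; have [[u ->] [v ->]] := conj (gdiffP x) (gdiffP y).
rewrite -[X in groth_lift X]/(gadd _ (gopp _)) goppE gaddE !groth_lift_diff /=.
by rewrite !fD !opprD opprK addrACA [- _ + f _]addrC.
Qed.

End Lift.

Lemma groth_liftM (T : comPzRingType) (f : R -> T) :
  {morph f : a b / a + b} -> {morph f : a b / a * b} ->
  {morph groth_lift f : x y / x * y}.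
Proof.
move=> fD fM x y; have [[u ->] [v ->]] := conj (gdiffP x) (gdiffP y).
rewrite -[X in groth_lift f X]/(gmul _ _) gmulE !(groth_lift_diff fD) /=.
by rewrite !fD !fM; ring.
Qed.

End Grothendieck.

Section Burnside.

Local Open Scope ring_scope.

Variables (gT : finGroupType) (G : {group gT}).

Definition burnside := groth (gclasses G).

HB.instance Definition _ := GRing.ComPzRing.on burnside.

Definition bclass (X : gset G) : burnside := groth_of (gclass X).

(** The map Phi_P; it is meaningful for P \subset G (see [mark_class]). *)
Definition mark_plus (P : {group gT}) (x : gclasses G) : int :=
  #|'Fix_(gset_act (grepr x))(P)|%:Z.

Definition mark (P : {group gT}) : burnside -> int := groth_lift (mark_plus P).

Lemma card_fix_iso (P : {group gT}) (X Y : gset G) : P \subset G ->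
  gset_iso X Y -> #|'Fix_(gset_act X)(P)| = #|'Fix_(gset_act Y)(P)|.
Proof.
move=> /fintype.subsetP PG [f bf hf]; rewrite -(card_imset _ (bij_inj bf)).
have [f' fK f'K] := bf.
apply: eq_card => y; apply/imsetP/afixP=> [[x /afixP fx ->] g Pg|fy].
  by rewrite -hf ?PG // fx.
exists (f' y); last by rewrite f'K.
apply/afixP=> g Pg; apply: (can_inj fK).
by rewrite hf ?PG // f'K fy.
Qed.

Lemma mark_plusE (P : {group gT}) (X : gset G) : P \subset G ->
  mark_plus P (gclass X) = #|'Fix_(gset_act X)(P)|%:Z.
Proof. by move=> PG; congr (_%:Z); apply: card_fix_iso => //; apply: gclassK. Qed.

Lemma mark_plusD (P : {group gT}) : P \subset G ->
  {morph mark_plus P : x y / x + y}.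
Proof.
move=> PG x y; have [[X ->] [Y ->]] := conj (gclassP x) (gclassP y).
rewrite -gclass_sum !mark_plusE // -PoszD; congr (_%:Z).
rewrite -[LHS]sum1_card big_sumType /= !sum1_card.
congr (_ + _)%N; apply: eq_card => z; apply/afixP/afixP => h g Pg.
- by have [] := h g Pg.
- by rewrite /= h.
- by have [] := h g Pg.
- by rewrite /= h.
Qed.

Lemma mark_plusM (P : {group gT}) : P \subset G ->
  {morph mark_plus P : x y / x * y}.
Proof.
move=> PG x y; have [[X ->] [Y ->]] := conj (gclassP x) (gclassP y).
rewrite -gclass_prod !mark_plusE // -PoszM -cardsX; congr (_%:Z).
apply: eq_card => -[u v]; rewrite finset.in_setX.
apply/afixP/andP => [h|[/afixP hu /afixP hv] g Pg].
  by split; apply/afixP=> g /h [].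
by rewrite /= /prod_act /= hu ?hv.
Qed.

Lemma mark_plus1 (P : {group gT}) : P \subset G -> mark_plus P 1 = 1.
Proof.
move=> PG; rewrite -[X in mark_plus _ X]/(gclass _) mark_plusE //.
rewrite (_ : 'Fix__(P) = [set: unit]) ?finset.cardsT ?card_unit //.
by apply/setP=> x; rewrite finset.in_setT; apply/afixP.
Qed.

Lemma mark_class (P : {group gT}) (X : gset G) : P \subset G ->
  mark P (bclass X) = #|'Fix_(gset_act X)(P)|%:Z.
Proof.
by move=> PG; rewrite /mark groth_liftE ?mark_plusE //; apply: mark_plusD.
Qed.

Lemma markB (P : {group gT}) : P \subset G -> {morph mark P : x y / x - y}.
Proof. by move=> PG; apply/groth_liftB/mark_plusD. Qed.

Lemma markM (P : {group gT}) : P \subset G -> {morph mark P : x y / x * y}.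
Proof. by move=> PG; apply: groth_liftM; [apply: mark_plusD|apply: mark_plusM]. Qed.

Lemma mark1 (P : {group gT}) : P \subset G -> mark P 1 = 1.
Proof.
move=> PG; rewrite -groth_of1 /mark groth_liftE ?mark_plus1 //.
exact: mark_plusD.
Qed.

Fact burnside_nonzero1 : (1 : burnside) != 0.
Proof.
apply/eqP=> /(congr1 (mark 1%G)); rewrite mark1 ?sub1G // -(subrr 0) markB ?sub1G //.
by rewrite subrr.
Qed.

HB.instance Definition _ :=
  GRing.PzSemiRing_isNonZero.Build burnside burnside_nonzero1.

(** [x] is the sum of the [c R *: [G/R]], R ranging over representatives of
    the G-conjugacy classes of subgroups of G; requiring c to be constant on
    these classes makes [c R] the coefficient of [G/R] in x for every R. *)
Definition orbit_coefs (x : burnside) (c : {group gT} -> int) : Prop :=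
  (forall (R : {group gT}) g, R \subset G -> g \in G -> c (R :^ g)%G = c R) /\
  x = \sum_(R in orbit_transversal 'JG G (subgroups G))
        bclass (coset_gset G R) *~ c R.

End Burnside.

Section Restriction.

Local Open Scope ring_scope.

Variables (aT gT : finGroupType) (P : {group aT}) (G : {group gT}).
Variables (f : {morphism P >-> gT}) (fG : f @* P \subset G).

Lemma sub_restr_dom : P \subset f @*^-1 G.
Proof. by rewrite -sub_morphim_pre. Qed.

Definition restr_gset (X : gset G) : gset P :=
  Gset ((gset_act X \o f) \ sub_restr_dom)%act.

Definition restr_plus (x : gclasses G) : burnside P :=
  bclass (restr_gset (grepr x)).

Definition restr : burnside G -> burnside P := groth_lift restr_plus.

Lemma restr_gset_iso X Y : gset_iso X Y ->
  gset_iso (restr_gset X) (restr_gset Y).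
Proof.
case=> h bh hh; exists h => // x g Pg; apply: hh.
by apply: (fintype.subsetP fG); apply: mem_morphim.
Qed.

Lemma restr_plusE X : restr_plus (gclass X) = bclass (restr_gset X).
Proof.
by rewrite /restr_plus /bclass; congr groth_of; apply/eq_gclass/restr_gset_iso/gclassK.
Qed.

Lemma restr_plusD : {morph restr_plus : x y / x + y}.
Proof.
move=> x y; have [[X ->] [Y ->]] := conj (gclassP x) (gclassP y).
rewrite -gclass_sum !restr_plusE /bclass -groth_ofD -gclass_sum.
congr groth_of; apply/eq_gclass; exists id; first by exists id.
by case.
Qed.

Lemma restr_plusM : {morph restr_plus : x y / x * y}.
Proof.
move=> x y; have [[X ->] [Y ->]] := conj (gclassP x) (gclassP y).
rewrite -gclass_prod !restr_plusE /bclass -groth_ofM -gclass_prod.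
congr groth_of; apply/eq_gclass; exists id; first by exists id.
by case.
Qed.

Lemma restr_class X : restr (bclass X) = bclass (restr_gset X).
Proof. by rewrite /restr groth_liftE ?restr_plusE //; apply: restr_plusD. Qed.

Lemma restrB : {morph restr : x y / x - y}.
Proof. exact/groth_liftB/restr_plusD. Qed.

Lemma restrM : {morph restr : x y / x * y}.
Proof. by apply: groth_liftM; [apply: restr_plusD|apply: restr_plusM]. Qed.

Lemma restr1 : restr 1 = 1.
Proof.
rewrite -[LHS]/(restr (bclass (triv_gset G unit))) restr_class.
congr groth_of; apply/eq_gclass; exists id; first by exists id.
by [].
Qed.

End Restriction.

Section BurnsideFusion.

Local Open Scope ring_scope.

Variables (gT : finGroupType) (S : {group gT}) (F : fusion_system S).
Implicit Types (P Q R : {group gT}) (X : burnside S).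

Definition fstable : pred (burnside S) := fun X =>
  `[< forall P (f : {morphism P >-> gT})
        (fS : f @* P \subset S) (iS : idm P @* P \subset S),
      fhom F P S f -> restr fS X = restr iS X >].

Fact fstable_subring : subring_closed fstable.
Proof.
split.
- by apply/asboolP=> P f fS iS _; rewrite !restr1.
- move=> x y /asboolP hx /asboolP hy; apply/asboolP=> P f fS iS Ff.
  by rewrite !restrB (hx P f fS iS) // (hy P f fS iS).
- move=> x y /asboolP hx /asboolP hy; apply/asboolP=> P f fS iS Ff.
  by rewrite !restrM (hx P f fS iS) // (hy P f fS iS).
Qed.

HB.instance Definition _ :=
  GRing.isSubringClosed.Build (burnside S) fstable fstable_subring.

Record fburnside := FBurnside {
  fburnside_val :> burnside S;
  fburnside_fstable : fburnside_val \in fstable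
}.

HB.instance Definition _ := [isSub for fburnside_val].
HB.instance Definition _ := [Choice of fburnside by <:].
HB.instance Definition _ :=
  [SubChoice_isSubComNzRing of fburnside by <:].

Definition fmark P (X : fburnside) : int := mark P (fburnside_val X).

Definition fully_normalized P : Prop :=
  P \subset S /\ forall Q, Q \in fclass F P -> (#|'N_S(Q)| <= #|'N_S(P)|)%N.

(** The characteristic properties of the basis of A(F) constructed by Reeh.
    The element written alpha_[P] is [alpha (fclass F P)]; the values of alpha
    outside Cl(F) are irrelevant. *)
Record reeh_basis (alpha : {set {group gT}} -> fburnside) : Prop := ReehBasis {
  reeh_effective : forall C, C \in Cl F ->
    exists x : gclasses S, fburnside_val (alpha C) = groth_of x;
  reeh_generates : forall X : fburnside,
    exists c : {set {group gT}} -> int, X = \sum_(C in Cl F) alpha C *~ c C;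
  reeh_free : forall c : {set {group gT}} -> int,
    \sum_(C in Cl F) alpha C *~ c C = 0 -> forall C, C \in Cl F -> c C = 0;
  reeh_coefs : forall P, P \subset S ->
    exists c, [/\ orbit_coefs (fburnside_val (alpha (fclass F P))) c,
      (forall R, R \subset S -> c R != 0 -> flesssim F R P),
      (forall P0, fully_normalized P0 -> P0 \in fclass F P -> c P0 = 1)
    & (forall Q0, fully_normalized Q0 -> Q0 \notin fclass F P -> c Q0 = 0)];
  reeh_mark_normalized : forall P0, fully_normalized P0 ->
    fmark P0 (alpha (fclass F P0)) = #|'N_S(P0) : P0|%g%:Z;
  reeh_mark_neq0 : forall P Q, P \subset S -> Q \subset S ->
    (fmark Q (alpha (fclass F P)) != 0) = flesssim F Q P;
  reeh_unit : alpha (fclass F S) = 1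
}.

End BurnsideFusion.

Section Ideals.

Local Open Scope ring_scope.
Local Open Scope classical_set_scope.

Variable A : comNzRingType.
Implicit Types (I : set A).

(** The prime ideals J of A such that A/J has characteristic q, where q is 0
    or a prime.  The ideals of the library are boolean predicates; in the
    classical setting of [boolp] every prime ideal is of this form. *)
Definition prime_ideals_of_type (q : nat) : set (set A) :=
  [set I | exists J : prime_idealr A, I = [set` (J : {pred A})] /\
     if q is 0%N then [pchar {ideal_quot J}] =i pred0
     else q \in [pchar {ideal_quot J}]].

Definition is_ideal I : Prop :=
  [/\ I 0, forall x y, I x -> I y -> I (x + y) & forall a x, I x -> I (a * x)].

Definition ideal_gen (E : set A) : set A := smallest is_ideal E.

End Ideals.

Section FusionIdeals.

Local Open Scope ring_scope.
Local Open Scope classical_set_scope.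

Variables (gT : finGroupType) (S : {group gT}) (F : fusion_system S).

Definition ideal_mod (P : {group gT}) (q : nat) : set (fburnside F) :=
  [set X | fmark P X = 0 %[mod q%:Z]]%Z.

Definition ideal0 (P : {group gT}) : set (fburnside F) :=
  [set X | fmark P X = 0].

End FusionIdeals.

Arguments prime_ideals_of_type A q : clear implicits.
Arguments ideal_mod {gT S} F P q _.
Arguments ideal0 {gT S} F P _.

(* Main.v *)
From HB Require Import structures.
Require Import Defs.
From mathcomp Require Import all_boot all_order all_algebra all_fingroup.
From mathcomp Require Import pgroup sylow ring boolp.

(** The marks [Phi_P] embed A(F) into a finite product of copies of Z. Hence a
    prime ideal J contains the product of the kernels of the marks, so it
    contains one of these kernels; as A(F) / ker Phi_P = Z, J is the inverse
    image under Phi_P of a prime ideal of Z. For a p-group all marks agree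
    modulo p. For q <> p (or q = 0) the ideals attached to distinct classes
    differ because, for m large, |S|^m times the indicator function of an
    F-conjugacy class is the mark function of an element of A(F). The
    generators are read off from the expansion in Reeh's basis, using that
    alpha_[S] = 1 and that Phi_S kills the other basis elements. *)

Set Implicit Arguments.
Unset Strict Implicit.
Unset Printing Implicit Defensive.

Import GroupScope GRing.Theory Num.Theory.

(** * Finite G-sets with equal marks *)

Section GSetIso.

Local Open Scope group_scope.

Variables (gT : finGroupType) (G : {group gT}).
Implicit Types (X Y : gset G) (P H : {group gT}).

Definition with_stab X H : {set X} := [set x | 'C_G[x | gset_act X] == H].

Lemma sub_stab X P x :
  P \subset G -> (P \subset 'C_G[x | gset_act X]) = (x \in 'Fix_(gset_act X)(P)).
Proof.
move=> PG; rewrite subsetI PG /=.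
apply/subsetP/afixP=> h g Pg.
  by have := h g Pg; rewrite !inE sub1set inE => /andP[_ /eqP].
by rewrite !inE (subsetP PG) //= sub1set inE h.
Qed.

(** A point is fixed by [P] exactly when its stabilizer contains [P], so the fixed points can be
    sorted by stabilizer. *)
Lemma card_fix_stab X P : P \subset G ->
  #|'Fix_(gset_act X)(P)| =
    (\sum_(H : {group gT} | (P \subset H) && (H \subset G)) #|with_stab X H|)%N.
Proof.
move=> PG; rewrite -sum1_card.
rewrite (partition_big (fun x => 'C_G[x | gset_act X]%G)
           (fun H => (P \subset H) && (H \subset G))) /=.
  apply: eq_bigr => H /andP[PH _]; rewrite -sum1_card; apply: eq_bigl => x.
  rewrite [RHS]inE -sub_stab //; apply/andP/eqP => [[_ /eqP <-] //|e].
  by split; [rewrite e | apply/eqP/group_inj].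
by move=> x; rewrite -sub_stab // => ->; rewrite subsetIl.
Qed.

Section SameMarks.

Variables X Y : gset G.
Hypothesis eq_fix : forall P, P \subset G ->
  #|'Fix_(gset_act X)(P)| = #|'Fix_(gset_act Y)(P)|.

(** The equations of [card_fix_stab] are triangular for inclusion, with coefficient 1 at [H] itself.
    They are solved by descending induction on the order of [H]. *)
Lemma eq_card_stab H : H \subset G -> #|with_stab X H| = #|with_stab Y H|.
Proof.
have [n] := ubnP (#|G| - #|H|); elim: n H => // n IH H; rewrite ltnS => le_n HG.
have := eq_fix HG; rewrite !card_fix_stab //.
rewrite (bigD1 H) ?subxx //= [in RHS](bigD1 H) ?subxx //=.
rewrite (eq_bigr (fun K => #|with_stab Y K|)); first by move/addIn.
move=> K /andP[/andP[HK KG] neKH]; apply: IH => //.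
apply: leq_trans le_n; apply: ltn_sub2l; last first.
  by apply: proper_card; rewrite properEneq HK andbT eq_sym.
apply: leq_trans (subset_leq_card KG).
by apply: proper_card; rewrite properEneq HK andbT eq_sym.
Qed.

Lemma eq_card_gset : #|X| = #|Y|.
Proof.
have fix1 (Z : gset G) : #|'Fix_(gset_act Z)(1%G)| = #|Z|.
  by apply: eq_card => z; apply/afixP=> g /set1P->; rewrite act1.
by rewrite -!fix1 eq_fix ?sub1G.
Qed.

(* Isomorphisms are built by extending equivariant injections defined on
   G-stable subsets, one orbit at a time. *)
Definition partial_iso (D : {set X}) (f : X -> Y) : Prop :=
  {in D &, injective f} /\
  forall x g, x \in D -> g \in G ->
    gset_act X x g \in D /\ f (gset_act X x g) = gset_act Y (f x) g.

Lemma partial_iso_stab D f x : partial_iso D f -> x \in D ->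
  'C_G[f x | gset_act Y] = 'C_G[x | gset_act X].
Proof.
case=> injf eqf Dx; apply/setP=> g; rewrite !inE; case Gg: (g \in G) => //=.
rewrite !sub1set !inE; have [Dxg <-] := eqf x g Dx Gg.
by rewrite (inj_in_eq injf).
Qed.

(** Since [f] preserves stabilizers, the points of [f @: D] with the stabilizer of [x] come from
    points of [D] with that stabilizer. These miss [x], so they are too few to exhaust
    [with_stab Y H]. *)
Lemma partial_iso_new_point D f x : partial_iso D f -> x \notin D ->
  exists2 y, y \notin f @: D & 'C_G[y | gset_act Y] = 'C_G[x | gset_act X].
Proof.
move=> isof Dx; pose H := 'C_G[x | gset_act X]%G.
have /subsetPn[y Hy Dy] : ~~ (with_stab Y H \subset f @: D).
  apply/negP=> sHD.
  have : with_stab Y H \subset f @: (D :&: with_stab X H).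
    apply/subsetP=> y Hy; have /imsetP[z Dz y_z] := subsetP sHD y Hy.
    rewrite y_z imset_f // in_setI Dz; move: Hy.
    by rewrite !inE y_z (partial_iso_stab isof Dz).
  move/subset_leq_card; rewrite -eq_card_stab ?subsetIl // leqNgt => /negP[].
  apply: leq_ltn_trans (leq_imset_card _ _) _; apply: proper_card.
  rewrite properE subsetIr; apply/subsetPn; exists x; first by rewrite inE.
  by rewrite inE (negPf Dx).
by exists y => //; move: Hy; rewrite inE => /eqP.
Qed.

(** Choose [y] outside the image with the same stabilizer as [x], and send the translate of [x] by
    [g] to the translate of [y] by [g]. Equality of stabilizers makes this well defined and
    injective. *)
Lemma partial_iso_extend D f x : partial_iso D f -> x \notin D ->
  exists f', partial_iso (D :|: orbit (gset_act X) G x) f'.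
Proof.
move=> isof nDx; have [y nDy eqC] := partial_iso_new_point isof nDx.
have [injf eqf] := isof; set a := gset_act X; set b := gset_act Y.
set O := orbit a G x.
have actE z g h : g \in G -> h \in G -> a z (g * h) = a (a z g) h.
  by move=> Gg Gh; rewrite actMin.
have bactE z g h : g \in G -> h \in G -> b z (g * h) = b (b z g) h.
  by move=> Gg Gh; rewrite actMin.
have same g h : g \in G -> h \in G -> (a x g == a x h) = (b y g == b y h).
  move=> Gg Gh; have Gk : g * h^-1 \in G by rewrite groupM ?groupV.
  have -> : (a x g == a x h) = (g * h^-1 \in 'C_G[x | a]).
    rewrite inE Gk !inE Gk sub1set !inE actE ?groupV //=.
    by rewrite (canF_eq (actKVin a Gh)).
  have -> : (b y g == b y h) = (g * h^-1 \in 'C_G[y | b]).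
    rewrite inE Gk !inE Gk sub1set !inE bactE ?groupV //=.
    by rewrite (canF_eq (actKVin b Gh)).
  by rewrite eqC.
(* [w z] is some element of [G] carrying [x] to [z]; the default 1 occurs only off the orbit of
   [x]. *)
pose w z := odflt 1 [pick g in G | a x g == z].
have wP z : z \in O -> w z \in G /\ a x (w z) = z.
  rewrite /w; case: pickP => [g /andP[Gg /eqP e] //|none].
  by case/orbitP=> g Gg e; have := none g; rewrite Gg e eqxx.
pose f' z := if z \in O then b y (w z) else f z.
have f'O g : g \in G -> f' (a x g) = b y g.
  move=> Gg; have Oxg : a x g \in O by apply: mem_orbit.
  rewrite /f' Oxg; have [Gw e] := wP _ Oxg.
  by apply/eqP; rewrite -same // e.
(* [D] and its image are stable under [G], so the orbits of [x] and [y] miss them. Hence the two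
   halves of [f'] neither overlap nor collide. *)
have nDO z g : z \in D -> g \in G -> a x g != z.
  move=> Dz Gg; apply: contraNneq nDx => e.
  have [] := eqf z g^-1 Dz (groupVr Gg).
  by rewrite -e -/a -actE ?groupV // mulgV act1.
have nfDO z g : z \in D -> g \in G -> b y g != f z.
  move=> Dz Gg; apply: contraNneq nDy => e.
  have [Dzg] := eqf z g^-1 Dz (groupVr Gg).
  by rewrite -e -/b -bactE ?groupV // mulgV act1 => <-; rewrite imset_f.
have f'D z : z \in D -> f' z = f z.
  move=> Dz; rewrite /f'; case: ifP => // /orbitP[g Gg e].
  by have := nDO z g Dz Gg; rewrite e eqxx.
exists f'; split.
  move=> u v /setUP[Du|/orbitP[g Gg <-]] /setUP[Dv|/orbitP[h Gh <-]].
  - by rewrite !f'D //; apply: injf.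
  - by rewrite f'D // f'O // => /esym/eqP; rewrite (negPf (nfDO _ _ _ _)).
  - by rewrite (f'D v) // f'O // => /eqP; rewrite (negPf (nfDO _ _ _ _)).
  - by rewrite !f'O // => /eqP; rewrite -same // => /eqP.
move=> z g /setUP[Dz|/orbitP[h Gh <-]] Gg.
  by have [Dzg e] := eqf z g Dz Gg; rewrite in_setU Dzg !f'D.
rewrite -/a -/b -actE // !f'O ?groupM // bactE // in_setU.
by rewrite mem_orbit ?orbT ?groupM.
Qed.

(** Starting from the empty partial isomorphism, orbits are added until the complement of the domain
    is empty. *)
Lemma gset_iso_of_fix : gset_iso X Y.
Proof.
suff ext n (D : {set X}) f : #|~: D| <= n -> partial_iso D f -> gset_iso X Y.
  (* The first domain is empty, so any map will do; this one exists because [X] and [Y] have equally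
     many points. *)
  pose f x : Y := enum_val (cast_ord eq_card_gset (enum_rank x)).
  apply: (@ext _ (set0 : {set X}) f (leqnn _)).
  by split=> [u v|u g]; rewrite inE.
elim: n D f => [|n IH] D f leDn isof.
  have DT x : x \in D.
    by move: leDn; rewrite leqn0 cards_eq0 => /eqP/setP/(_ x); rewrite !inE => /negbFE.
  have [injf eqf] := isof.
  exists f; first by apply: inj_card_bij; [move=> u v; apply: injf | rewrite eq_card_gset].
  by move=> x g Gg; have [] := eqf x g (DT x) Gg.
have [DT|[x nDx]] : D = setT \/ exists x, x \notin D.
  have [/subsetPn[x _ nDx]|] := boolP (~~ (setT \subset D)); first by right; exists x.
  by rewrite negbK subTset => /eqP; left.
  by apply: (IH D f) => //; rewrite DT setCT cards0.
have [f' isof'] := partial_iso_extend isof nDx.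
apply: IH isof'; rewrite -ltnS; apply: leq_trans leDn; apply: proper_card.
rewrite properE setCS subsetUl; apply/subsetPn; exists x; first by rewrite inE.
by rewrite !inE orbit_refl orbT.
Qed.

End SameMarks.

End GSetIso.

(** * Fixed points of conjugate subgroups and on coset spaces *)

Section FixedPoints.

Local Open Scope group_scope.

Variables (gT : finGroupType) (G : {group gT}).
Implicit Types (P R : {group gT}).

(** Translation by [g] carries the fixed points of [P] onto those of [P :^ g]. *)
Lemma card_fixJ (X : gset G) P g : P \subset G -> g \in G ->
  #|'Fix_(gset_act X)(P :^ g)| = #|'Fix_(gset_act X)(P)|.
Proof.
move=> PG Gg; set a := gset_act X.
rewrite -[RHS](card_imset _ (act_inj a g)); apply: eq_card => z.
apply/afixP/imsetP => [fz|[u /afixP fu ->] _ /imsetP[h Ph ->]].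
  exists (a z g^-1); last by rewrite -actMin ?groupV // mulVg act1.
  apply/afixP=> h Ph; have Gh := subsetP PG h Ph.
  rewrite -{2}(fz (h ^ g)) ?memJ_conjg // -!actMin ?groupV ?groupM ?groupV //.
  by rewrite conjgE -!mulgA mulgV mulg1.
have Gh := subsetP PG h Ph.
rewrite -actMin ?groupJ // conjgE !mulgA mulgV mul1g actMin //.
by rewrite fu.
Qed.

Lemma coset_gset_actE R x (xG : R :* x \in rcosets R G) g : g \in G ->
  val (gset_act (coset_gset G R) (exist _ (R :* x) xG) g) = R :* (x * g).
Proof.
move=> Gg; rewrite /= val_subact /= ifT ?rcosetE ?rcosetM //.
exact: (subsetP (sub_coset_dom G R)).
Qed.

(** The coset [R :* x] is fixed by [P] if and only if [P \subset R :^ x]. Hence the set on the right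
    is a union of cosets of [R], one per fixed point. *)
Lemma card_fix_coset P R : P \subset G -> R \subset G ->
  (#|R| * #|'Fix_(gset_act (coset_gset G R))(P)|)%N = #|[set x in G | P \subset R :^ x]|.
Proof.
move=> PG RG; set Fx := 'Fix_(_)(P).
have FxP x (xG : R :* x \in rcosets R G) : (exist _ (R :* x) xG \in Fx) = (P \subset R :^ x).
  apply/afixP/subsetP => h g Pg; have Gg := subsetP PG g Pg.
    have := congr1 val (h g Pg); rewrite coset_gset_actE //= => e.
    have : x * g \in R :* x by rewrite -e rcoset_refl.
    by rewrite mem_conjg mem_rcoset conjgE invgK mulgA.
  apply: val_inj; rewrite coset_gset_actE //=.
  apply/rcoset_eqP; rewrite mem_rcoset.
  by have := h g Pg; rewrite mem_conjg conjgE invgK mulgA.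
rewrite -(card_imset _ val_inj) mulnC -sum_nat_const -[RHS]sum1_card.
have FxP' x : x \in G -> (R :* x \in val @: Fx) = (P \subset R :^ x).
  move=> Gx; have xG : R :* x \in rcosets R G by apply/rcosetsP; exists x.
  by rewrite -(FxP x xG); exact: (mem_imset Fx (exist _ (R :* x) xG) val_inj).
rewrite [RHS](partition_big (fun x => R :* x) (mem (val @: Fx))) /=; last first.
  by move=> x /setIdP[Gx Px]; rewrite FxP'.
apply: eq_bigr => A FA; have [[B BG] FB eA] := imsetP FA.
have [y Gy eB] := rcosetsP BG; have {B BG FB eA eB} eA : A = R :* y by rewrite eA.
rewrite {}eA in FA *; rewrite -(card_rcoset R y) -sum1_card; apply: eq_bigl => x.
rewrite -[in LHS]/(x \in R :* y); apply/idP/andP=> [xy|[_ /eqP <-]]; last exact: rcoset_refl.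
have exy := rcoset_eqP xy; split; last by rewrite exy.
have Gx : x \in G.
  by have /rcosetP[r /(subsetP RG) Gr ->] := xy; rewrite groupM.
by rewrite inE Gx -FxP' // exy.
Qed.

End FixedPoints.

(** * Mark homomorphisms *)

Section Marks.

Local Open Scope ring_scope.

Variables (gT : finGroupType) (G : {group gT}).
Implicit Types (P Q R : {group gT}) (x y : burnside G).

(** Carrying the inclusion as an argument lets the ring morphism structure be attached to the
    mark. *)
Definition mark_at P of P \subset G := @mark gT G P.

Section MarkMorphism.
Variables (P : {group gT}) (PG : P \subset G).

Fact mark_at_zmod_morphism : zmod_morphism (mark_at PG).
Proof. exact: markB. Qed.

Fact mark_at_monoid_morphism : monoid_morphism (mark_at PG).
Proof. by split; [apply: mark1 | apply: markM]. Qed.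

HB.instance Definition _ :=
  GRing.isZmodMorphism.Build (burnside G) int (mark_at PG) mark_at_zmod_morphism.
HB.instance Definition _ :=
  GRing.isMonoidMorphism.Build (burnside G) int (mark_at PG) mark_at_monoid_morphism.

End MarkMorphism.

Lemma burnside_diff x : exists X Y : gset G, x = bclass X - bclass Y.
Proof.
have [[a b] ->] := gdiffP x; have [[X ->] [Y ->]] := conj (gclassP a) (gclassP b).
by exists X, Y; rewrite gdiffE.
Qed.

(** If [x - y] is the difference of two G-sets, these have equal fixed point counts for every
    subgroup and so are isomorphic. *)
Lemma mark_inj x y : (forall P, P \subset G -> mark P x = mark P y) -> x = y.
Proof.
move=> exy; apply/eqP; rewrite -subr_eq0.
have [X [Y e]] := burnside_diff (x - y); rewrite e subr_eq0; apply/eqP.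
congr groth_of; apply/eq_gclass/gset_iso_of_fix => P PG.
have := markB PG x y; rewrite e exy // subrr markB // !mark_class //.
by move/eqP; rewrite subr_eq0 => /eqP[].
Qed.

Lemma mark_conj P g x : P \subset G -> g \in G -> mark (P :^ g)%G x = mark P x.
Proof.
move=> PG Gg; have PgG : P :^ g \subset G by rewrite conj_subG.
have [X [Y ->]] := burnside_diff x.
by rewrite !markB // !mark_class //= !card_fixJ.
Qed.

(** For a [p]-group acting on a finite set, the number of fixed points is congruent to the size of
    the set, which does not depend on the subgroup. *)
Lemma mark_mod_p (p : nat) P Q x : prime p -> p.-group G ->
  P \subset G -> Q \subset G -> (mark P x = mark Q x %[mod p])%Z.
Proof.
move=> p_pr pG PG QG; have [X [Y ->]] := burnside_diff x.
have fix_mod R (Z : gset G) : R \subset G ->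
    (#|'Fix_(gset_act Z)(R)|%:Z = #|Z|%:Z %[mod p])%Z.
  move=> RG; rewrite !modz_nat; congr Posz; apply/esym.
  rewrite -cardsT; have -> : 'Fix_(gset_act Z)(R) = 'Fix_(setT | gset_act Z)(R) by rewrite setTI.
  apply: pgroup_fix_mod (pgroupS RG pG) _.
  by apply/subsetP=> g Rg; rewrite !inE (subsetP RG) //=; apply/subsetP=> z; rewrite !inE.
rewrite !markB // !mark_class //.
have dvd_fix (Z : gset G) : (p %| #|'Fix_(gset_act Z)(P)|%:Z - #|'Fix_(gset_act Z)(Q)|%:Z)%Z.
  by rewrite -eqz_mod_dvd !fix_mod.
have sub4 (a b c d : int) : a - b - (c - d) = (a - c) - (b - d) by ring.
by apply/eqP; rewrite eqz_mod_dvd sub4 rpredB.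
Qed.

Lemma card_mark_coset P R : P \subset G -> R \subset G ->
  #|R|%:Z * mark P (bclass (coset_gset G R)) = #|[set x in G | P \subset R :^ x]|%:Z.
Proof. by move=> PG RG; rewrite mark_class // -PoszM card_fix_coset. Qed.

(* Subtracting a suitable multiple of the classes [G/R] with [#|R| = m.+1]
   kills the values of [#|G| * f] on the subgroups of order [m.+1]. *)
Lemma ghost_multiple m (f : {group gT} -> int) :
  (forall P g, P \subset G -> g \in G -> f (P :^ g)%G = f P) ->
  (forall P, P \subset G -> (m < #|P|)%N -> f P = 0) ->
  exists x : burnside G, forall P, P \subset G -> mark P x = (#|G| ^ m)%:Z * f P.
Proof.
elim: m f => [|m IH] f fJ f0.
  exists 0 => P PG; rewrite f0 ?cardG_gt0 // mulr0; exact: raddf0 (mark_at PG).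
pose y := \sum_(R : {group gT} | (R \subset G) && (#|R| == m.+1))
             bclass (coset_gset G R) *~ f R.
have y_top P : P \subset G -> (m < #|P|)%N -> m.+1%:Z * mark P y = #|G|%:Z * f P.
  move=> PG ltmP.
  have -> : mark P y = \sum_(R : {group gT} | (R \subset G) && (#|R| == m.+1))
      mark P (bclass (coset_gset G R)) * f R.
    rewrite -[LHS]/(mark_at PG y) raddf_sum; apply: eq_bigr => R _.
    by rewrite raddfMz mulrzz.
  rewrite mulr_sumr.
  transitivity (\sum_(R : {group gT} | (R \subset G) && (#|R| == m.+1))
      \sum_(x in G | P \subset R :^ x) f R).
    apply: eq_bigr => R /andP[RG /eqP <-]; rewrite mulrA card_mark_coset //.
    rewrite sumr_const -mulr_natl natz; congr (Posz _ * _).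
    by apply: eq_card => x; rewrite !inE.
  rewrite (exchange_big_dep (mem G)) /=; last by move=> R x _ /andP[].
  rewrite -[#|G|%:Z]natz mulr_natl -sumr_const; apply: eq_bigr => x Gx.
  have PxG : P :^ x^-1 \subset G by rewrite conj_subG ?groupV.
  (* By orders, the inclusion is an equality, so each [x] contributes [f P] when [#|P| = m.+1].
     Otherwise [P] is larger, no [R] occurs, and [f P = 0]. *)
  have eqR R : [&& R \subset G, #|R| == m.+1 & P \subset R :^ x] =
      (R == (P :^ x^-1)%G) && (#|P| == m.+1).
    apply/and3P/andP => [[RG /eqP cR PR]|[/eqP -> /eqP cP]]; last first.
      by rewrite /= cardJg cP conjsgKV.
    have eqPR : P :=: R :^ x by apply/eqP; rewrite eqEcard PR cardJg cR.
    split; first by apply/eqP/group_inj; rewrite /= eqPR conjsgK.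
    by rewrite eqPR cardJg cR.
  rewrite (eq_bigl (fun R => (R == (P :^ x^-1)%G) && (#|P| == m.+1))); last first.
    by move=> R /=; rewrite Gx /= -eqR andbA.
  have [cP|ncP] := eqVneq #|P| m.+1.
    rewrite (eq_bigl (pred1 (P :^ x^-1)%G)) ?big_pred1_eq ?fJ ?groupV //.
    by move=> R; rewrite andbT.
  rewrite big_pred0 ?f0 // => [|R]; last by rewrite andbF.
  by rewrite ltn_neqAle eq_sym ncP.
(* The corrected function vanishes on orders above [m]. Once [x] realises [#|G| ^ m] times it,
   adding [m.+1 * #|G| ^ m] copies of [y] restores the subtracted term. *)
have [||x markx] := IH (fun P => #|G|%:Z * f P - m.+1%:Z * mark P y).
- by move=> P g PG Gg; rewrite fJ // mark_conj.
- by move=> P PG ltmP; rewrite y_top // subrr.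
exists (x + y *~ (m.+1 * #|G| ^ m)%:Z) => P PG.
rewrite -[LHS]/(mark_at PG _) raddfD raddfMz /= /mark_at markx // mulrzz.
by rewrite expnS !PoszM; ring.
Qed.

End Marks.

(** * Conjugacy in a fusion system *)

Section FusionConj.

Local Open Scope group_scope.

Variables (gT : finGroupType) (S : {group gT}) (F : fusion_system S).
Implicit Types (P Q R : {group gT}) (f : gT -> gT).

Lemma fhom_incl P Q : P \subset Q -> Q \subset S -> fhom F P Q id.
Proof.
move=> PQ QS; have PS := subset_trans PQ QS.
apply: fhom_ext (fhom_conj F PS QS (group1 S) _); last by rewrite conjsg1.
by move=> x _; rewrite /= conjg1.
Qed.

Lemma fisom_of_fhom P Q f : fhom F P Q f -> f @: P = Q -> exists g,
  [/\ fhom F Q P g, {in P, cancel f g} & {in Q, cancel g f}].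
Proof.
move=> Ff fPQ; have [_ injf _] := fhom_injmorph Ff.
(* The default 1 lies in [P], so [g] takes its values in [P] at every argument. *)
pose g y := odflt 1 [pick x in P | f x == y].
have gK : {in Q, cancel g f}.
  move=> y; rewrite -fPQ => /imsetP[x Px ->]; rewrite /g.
  by case: pickP => [z /andP[_ /eqP]|/(_ x)] //=; rewrite Px eqxx.
have fK : {in P, cancel f g}.
  move=> x Px; have Qfx : f x \in Q by rewrite -fPQ imset_f.
  apply: injf => //; last exact: gK.
  rewrite /g; case: pickP => [z /andP[] //|_] /=; exact: group1.
by exists g; split=> //; apply: fhom_inv Ff fPQ fK.
Qed.

(** A morphism onto [Q] is already an isomorphism, and finite functions may be replaced by arbitrary
    ones because morphisms matter only on their source. *)
Lemma fconjP P Q :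
  reflect (exists2 f, fhom F P Q f & f @: P = Q) (fconj F P Q).
Proof.
apply: (iffP existsP) => [[f /andP[Ff /existsP[g]]]|[f Ff fPQ]].
  case/and3P=> Fg _ /forall_inP gK; exists f => //.
  have [_ _ sfPQ] := fhom_injmorph Ff; have [_ _ sgQP] := fhom_injmorph Fg.
  apply/eqP; rewrite eqEsubset sfPQ; apply/subsetP=> y Qy.
  by rewrite -(eqP (gK y Qy)) !imset_f // (subsetP sgQP) ?imset_f.
have [g [Fg fK gK]] := fisom_of_fhom Ff fPQ.
exists [ffun x => f x]; apply/andP; split.
  by apply: fhom_ext Ff => x _; rewrite ffunE.
apply/existsP; exists [ffun x => g x]; apply/and3P; split.
- by apply: fhom_ext Fg => x _; rewrite ffunE.
- by apply/forall_inP=> x Px; rewrite !ffunE fK.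
- by apply/forall_inP=> x Px; rewrite !ffunE gK.
Qed.

Lemma fconj_refl P : P \subset S -> fconj F P P.
Proof. by move=> PS; apply/fconjP; exists id; rewrite ?imset_id ?fhom_incl. Qed.

Lemma fconj_sym P Q : fconj F P Q -> fconj F Q P.
Proof.
case/fconjP=> f Ff fPQ; have [g [Fg fK gK]] := fisom_of_fhom Ff fPQ.
apply/fconjP; exists g => //; rewrite -fPQ -imset_comp.
by rewrite -[RHS]imset_id; apply: eq_in_imset => x /fK.
Qed.

Lemma fconj_trans P Q R : fconj F P Q -> fconj F Q R -> fconj F P R.
Proof.
case/fconjP=> f Ff fPQ /fconjP[g Fg gQR]; apply/fconjP; exists (g \o f).
  exact: fhom_comp Ff Fg.
by rewrite imset_comp fPQ.
Qed.

Lemma fconj_conj P g : P \subset S -> g \in S -> fconj F P (P :^ g)%G.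
Proof.
move=> PS Sg; have PgS : P :^ g \subset S by rewrite conj_subG.
by apply/fconjP; exists (conjg^~ g) => //; apply: fhom_conj.
Qed.

Lemma mem_fclass P Q : (Q \in fclass F P) = (Q \subset S) && fconj F P Q.
Proof. by rewrite inE in_set. Qed.

Lemma fconj_sub P Q : fconj F P Q -> P \subset S /\ Q \subset S.
Proof. by case/fconjP=> f /fhom_obj. Qed.

Lemma eq_fclass P Q : P \subset S -> Q \subset S ->
  fclass F P = fclass F Q <-> fconj F P Q.
Proof.
move=> PS QS; split=> [e|PQ].
  have : Q \in fclass F Q by rewrite mem_fclass QS fconj_refl.
  by rewrite -e mem_fclass => /andP[].
apply/setP=> R; rewrite !mem_fclass; case: (R \subset S) => //=.
apply/idP/idP; last exact: fconj_trans.
exact/fconj_trans/fconj_sym.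
Qed.

Lemma flesssim_card P Q : flesssim F P Q -> #|P| <= #|Q|.
Proof.
case/existsP=> f /fhom_injmorph[_ injf sfPQ].
by rewrite -(card_in_imset injf) subset_leq_card.
Qed.

End FusionConj.

(** * Marks of restricted elements *)

Section Restriction.

Local Open Scope ring_scope.

Variables (aT gT : finGroupType) (P : {group aT}) (G : {group gT}).
Variables (f : {morphism P >-> gT}) (fG : f @* P \subset G).

Lemma mark_restr (R : {group aT}) (X : burnside G) : R \subset P ->
  mark R (restr fG X) = mark (f @* R)%G X.
Proof.
move=> RP; have fRG : f @* R \subset G := subset_trans (morphimS f RP) fG.
have [Y [Z ->]] := burnside_diff X.
rewrite (restrB fG (bclass Y) (bclass Z)) !restr_class !markB // !mark_class //.
suff fixE (W : gset G) : 'Fix_(gset_act (restr_gset fG W))(R) = 'Fix_(gset_act W)(f @* R).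
  by rewrite !fixE.
apply/setP=> w; apply/afixP/afixP => [h _ /morphimP[x Px Rx ->]|h x Rx].
  exact: (h x Rx).
by apply: h; rewrite mem_morphim // (subsetP RP).
Qed.

End Restriction.

(** * Stability in terms of marks *)

Section FusionStable.

Local Open Scope ring_scope.

Variables (gT : finGroupType) (S : {group gT}) (F : fusion_system S).
Implicit Types (P Q R : {group gT}) (X : burnside S).

(** At [R \subset P], the restrictions along [f] and along the inclusion have as marks those of [X]
    at [f @* R] and at [R]. Since marks separate the elements of the Burnside ring of [P], comparing
    restrictions amounts to comparing marks. *)
Lemma fstable_mark X : X \in fstable F <->
  forall P Q, fconj F P Q -> mark P X = mark Q X.
Proof.
split=> [/asboolP stabX P Q /fconjP[f Ff fPQ]|eqX].
  have [PS QS] := fhom_obj Ff; have [fM _ _] := fhom_injmorph Ff.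
  pose m := Morphism fM.
  have mP : (m @* P)%G = Q by apply/group_inj; rewrite /= morphimEdom.
  have iP : (idm P @* P)%G = P by apply/group_inj; rewrite /= morphim_idm.
  have mS : m @* P \subset S by move: QS; rewrite -mP.
  have iS : idm P @* P \subset S by rewrite morphim_idm.
  have := congr1 (mark P) (stabX P m mS iS (fhom_comp Ff (fhom_incl F QS (subxx S)))).
  by rewrite !mark_restr // mP iP.
apply/asboolP=> P f fS iS Ff; apply: mark_inj => R RP.
rewrite !mark_restr //.
have -> : (idm P @* R)%G = R by apply/group_inj; rewrite /= morphim_idm.
have [PS _] := fhom_obj Ff.
apply/esym/eqX/fconjP; exists f; last by rewrite /= morphimEsub.
apply: (@fhom_corestr _ _ _ R S); last by rewrite /= morphimEsub.
exact: fhom_comp (fhom_incl F RP PS) Ff.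
Qed.

Lemma fmark_fconj P Q (X : fburnside F) : fconj F P Q -> fmark P X = fmark Q X.
Proof. by move=> PQ; apply: (fstable_mark _).1 PQ; apply: fburnside_fstable. Qed.

Definition fmark_at P of P \subset S := @fmark gT S F P.

Section FmarkMorphism.
Variables (P : {group gT}) (PS : P \subset S).

Fact fmark_at_zmod_morphism : zmod_morphism (fmark_at PS).
Proof. by move=> X Y; apply: markB. Qed.

Fact fmark_at_monoid_morphism : monoid_morphism (fmark_at PS).
Proof. by split; [apply: mark1 | move=> X Y; apply: markM]. Qed.

HB.instance Definition _ :=
  GRing.isZmodMorphism.Build (fburnside F) int (fmark_at PS) fmark_at_zmod_morphism.
HB.instance Definition _ :=
  GRing.isMonoidMorphism.Build (fburnside F) int (fmark_at PS) fmark_at_monoid_morphism.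

End FmarkMorphism.

Lemma fmark_inj (X Y : fburnside F) :
  (forall P, P \subset S -> fmark P X = fmark P Y) -> X = Y.
Proof. by move=> eXY; apply: val_inj; apply: mark_inj. Qed.

(** This is [ghost_multiple] for the indicator function of the class of [P]. With [m = #|S|] no
    subgroup has order above [m], and the resulting element is stable because its marks are constant
    on classes. *)
Lemma fburnside_indicator P : P \subset S -> exists X : fburnside F,
  forall Q, Q \subset S -> fmark Q X = (#|S| ^ #|S|)%:Z *+ fconj F P Q.
Proof.
move=> PS; pose f Q : int := (fconj F P Q)%:R.
have f_fconj Q R : fconj F Q R -> f Q = f R.
  move=> QR; rewrite /f; congr (nat_of_bool _)%:R.
  by apply/idP/idP => PQ; apply: fconj_trans PQ _ => //; apply: fconj_sym.
have [||x markx] := @ghost_multiple _ S #|S| f.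
- by move=> Q g QS Sg; rewrite (f_fconj Q _ (fconj_conj F QS Sg)).
- by move=> Q QS; rewrite ltnNge subset_leq_card.
have stabx : x \in fstable F.
  apply/fstable_mark=> Q R QR; have [QS RS] := fconj_sub QR.
  by rewrite !markx // (f_fconj Q R).
by exists (FBurnside stabx) => Q QS; rewrite /fmark markx // /f mulr_natr.
Qed.

End FusionStable.

From mathcomp Require Import boolp classical_sets functions cardinality.
Local Open Scope ring_scope.
Local Open Scope classical_set_scope.
Local Open Scope card_scope.

(** * Prime ideals *)

Lemma quot_natr_eq0 (A : comNzRingType) (J : idealr A) n :
  (n%:R == 0 :> {ideal_quot J}) = (n%:R \in J).
Proof.
rewrite -(rmorph_nat (\pi_({ideal_quot J}))%qT) -[in RHS](subr0 n%:R).
by rewrite Quotient.idealrBE rmorph0.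
Qed.

Section FusionPrimes.

Variables (gT : finGroupType) (S : {group gT}) (F : fusion_system S).
Implicit Types (P Q : {group gT}) (X Y : fburnside F) (J : prime_idealr (fburnside F)).

Lemma ideal_modP P q X : ideal_mod F P q X <-> (q %| fmark P X)%Z.
Proof.
rewrite /ideal_mod /= -[X in _ <-> is_true (_ %| X)%Z]subr0 -eqz_mod_dvd.
by split=> /eqP.
Qed.

Lemma ideal_mod0 P : ideal_mod F P 0 = ideal0 F P.
Proof.
by apply/seteqP; split=> X /=; rewrite ideal_modP dvd0z => /eqP.
Qed.

Definition char_or0 q := (q == 0)%N || prime q.

Section Instance.

Variables (P : {group gT}) (PS : P \subset S) (q : nat) (q_char : char_or0 q).

(* The proofs are arguments so that the ideal instances attach to the predicate. *)
Definition mark_dvd of P \subset S & char_or0 q : pred (fburnside F) :=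
  fun X => (q %| fmark P X)%Z.

Local Notation I := (mark_dvd PS q_char).

Lemma mark_dvdE X : (X \in I) = (q %| fmark_at PS X)%Z. Proof. by []. Qed.

Fact mark_dvd_idealr : idealr_closed I.
Proof.
split=> [||X Y Z IY IZ]; rewrite !mark_dvdE ?rmorph0 ?dvdz0 // ?rmorph1.
  rewrite dvdz1; case: eqP => // q1; move: q_char; rewrite /char_or0.
  by case: (q) q1 => [|[|?]].
by rewrite rmorphD rmorphM rpredD ?dvdz_mull.
Qed.

Fact mark_dvd_prime : prime_idealr_closed I.
Proof.
move=> X Y; rewrite !mark_dvdE rmorphM.
have [/eqP ->|q_pr] := orP q_char; last by rewrite !dvdzE abszM Euclid_dvdM.
by rewrite !dvd0z mulf_eq0.
Qed.

HB.instance Definition _ := isIdealr.Build (fburnside F) I mark_dvd_idealr.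
HB.instance Definition _ :=
  isPrimeIdealrClosed.Build (fburnside F) I mark_dvd_prime.

Definition mark_dvd_ideal : prime_idealr (fburnside F) := I.

End Instance.

(** Marks are unital ring homomorphisms to the integers, so they send [n%:R] to [n]. *)
Lemma natr_ideal_mod P q J n : P \subset S -> [set` J] = ideal_mod F P q ->
  (n%:R \in J) = (q %| n)%N.
Proof.
move=> PS eJ; have -> : (n%:R \in J) = `[< ideal_mod F P q n%:R >].
  by rewrite -eJ asboolb.
rewrite -[(q %| n)%N]/(`|q%:Z| %| `|n%:Z|)%N -dvdzE -natz.
by rewrite -(rmorph_nat (@fmark_at _ _ F _ PS)) -[RHS]asboolb; congr asbool; apply/propext/ideal_modP.
Qed.

Lemma pchar_natP (A : comNzRingType) (J' : idealr A) q :
  (if q is 0%N then [pchar {ideal_quot J'}] =i pred0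
     else q \in [pchar {ideal_quot J'}]) <->
  if q is 0%N then forall r, prime r -> r%:R \notin J' else prime q /\ q%:R \in J'.
Proof.
have in_pchar r : (r \in [pchar {ideal_quot J'}]) = prime r && (r%:R \in J').
  by rewrite inE quot_natr_eq0.
case: q => [|q]; last by rewrite in_pchar; split=> /andP.
split=> h r; first by move=> r_pr; have := h r; rewrite in_pchar r_pr /= => ->.
by rewrite in_pchar; apply/andP=> -[/h /negP].
Qed.

(** The integers in this ideal are the multiples of [q], and they determine the characteristic of
    the quotient. *)
Lemma prime_ideals_of_type_mod P q r : P \subset S -> char_or0 q ->
  prime_ideals_of_type (fburnside F) r (ideal_mod F P q) <-> r = q.
Proof.
move=> PS q_char; split=> [[J [/esym eJ /pchar_natP]]|->].
  case: r => [|r]; last rewrite (natr_ideal_mod _ PS eJ) => -[r_pr].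
    case/orP: q_char => [/eqP -> //|q_pr] /(_ q q_pr).
    by rewrite (natr_ideal_mod _ PS eJ) dvdnn.
  case/orP: q_char => [/eqP ->|q_pr]; first by rewrite dvd0n.
  by rewrite dvdn_prime2 // => /eqP.
exists (mark_dvd_ideal PS q_char); have eJ : ideal_mod F P q = [set` mark_dvd_ideal PS q_char].
  by apply/seteqP; split=> X /ideal_modP.
split=> //; apply/pchar_natP; case: q q_char eJ => [|q] q_char eJ.
  by move=> l l_pr; rewrite (natr_ideal_mod _ PS (esym eJ)) dvd0n -lt0n prime_gt0.
by rewrite (natr_ideal_mod _ PS (esym eJ)) dvdnn; have [|q_pr] := orP q_char.
Qed.

(** Otherwise each [P] has an element with zero mark at [P] lying outside [J]. The product of these
    elements has all marks zero, so it is 0 and lies in [J], against primality. *)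
Lemma prime_ideal_contains_ker J :
  exists2 P : {group gT}, P \subset S & forall X, fmark P X = 0 -> X \in J.
Proof.
apply: contrapT => none.
have wit P : exists X : fburnside F, P \subset S -> fmark P X = 0 /\ X \notin J.
  have [PS|] := boolP (P \subset S); last by exists 0.
  apply: contrapT => noX; apply: none; exists P => // X fX0.
  by apply: contrapT => /negP JX; apply: noX; exists X.
have [X XP] := choice wit.
have : \prod_(P : {group gT} | P \subset S) X P \in J.
  suff -> : \prod_(P : {group gT} | P \subset S) X P = 0 by rewrite idealr0.
  apply: fmark_inj => Q QS; rewrite -[LHS]/(fmark_at QS _) -[RHS]/(fmark_at QS _).
  rewrite (bigD1 Q) //= rmorphM rmorph0.
  by have [e _] := XP Q QS; rewrite [Z in Z * _]e mul0r.
apply/negP; elim/big_ind: _ => [|x y Jx Jy|P PS]; first by rewrite idealr1.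
  by rewrite prime_idealrM negb_or Jx.
by have [] := XP P PS.
Qed.

(** If [J] contains the kernel of the mark at [P], it contains each [X] minus the constant
    [fmark P X]. Membership in [J] thus depends only on that integer, and the integers in [J] are
    the multiples of some [q]. *)
Lemma prime_ideal_eq_mod J :
  exists (P : {group gT}) q, [/\ P \subset S, char_or0 q & [set` J] = ideal_mod F P q].
Proof.
have [P PS kerJ] := prime_ideal_contains_ker J; exists P.
have J_mark X : (X \in J) = ((fmark P X)%:~R \in J).
  have JX : X - (fmark P X)%:~R \in J.
    apply: kerJ; rewrite -[LHS]/(fmark_at PS _) rmorphB rmorph_int.
    by rewrite intz subrr.
  by rewrite -[in LHS](subrK (fmark P X)%:~R X) rpredDl.
have J_int (n : int) : (n%:~R \in J) = (`|n|%:R \in J).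
  by case: n => n; last rewrite -[LHS]/(- (n.+1%:R) \in J) rpredN.
suff [q q_char Jq] : exists2 q, char_or0 q & forall n, (n%:R \in J) = (q %| n)%N.
  exists q; split=> //; apply/seteqP.
  by split=> X; [move=> JX; apply/ideal_modP | move/ideal_modP => JX /=];
    move: JX; rewrite dvdzE -Jq -J_int -J_mark.
have [[n n_gt0 Jn]|none] := pselect (exists2 n, (n > 0)%N & n%:R \in J); last first.
  exists 0%N => // n; rewrite dvd0n; case: n => [|n]; first by rewrite idealr0.
  by apply/negP=> Jn; apply: none; exists n.+1.
(* The least positive integer in [J] divides all the others, by Euclidean division. *)
have ex : exists n, (n > 0)%N && (n%:R \in J) by exists n; rewrite n_gt0.
case: (ex_minnP ex) => q /andP[q_gt0 Jq] q_min.
have JqE m : (m%:R \in J) = (q %| m)%N.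
  apply/idP/dvdnP => [Jm|[k ->]]; last by rewrite natrM idealMr.
  exists (m %/ q)%N; rewrite {1}(divn_eq m q).
  have : (m %% q)%:R \in J.
    by move: Jm; rewrite {1}(divn_eq m q) natrD natrM rpredDl ?idealMr.
  case: (posnP (m %% q)) => [-> //|r_gt0 Jr]; first by rewrite addn0.
  have := q_min (m %% q)%N; rewrite r_gt0 Jr => /(_ isT).
  by rewrite leqNgt ltn_pmod.
exists q => //; apply/orP; right; apply/primeP; split.
  by move: q_gt0; rewrite leq_eqVlt => /predU1P[q1|//]; move: Jq; rewrite -q1 idealr1.
(* If [q = k * d], primality of [J] puts one factor in [J]; that factor is a multiple of [q], so the
   other is 1. *)
move=> d /dvdnP[k q_kd]; move: Jq; rewrite q_kd natrM prime_idealrM !JqE q_kd.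
have [k_gt0 d_gt0] : (0 < k /\ 0 < d)%N by apply/andP; rewrite -muln_gt0 -q_kd.
rewrite -{2}[k]muln1 dvdn_pmul2l // dvdn1 -{3}[d]mul1n dvdn_pmul2r // dvdn1.
by rewrite -{3}[d]mul1n eqn_pmul2r // eq_sym [1%N == k]eq_sym orbC => /orP[]->; rewrite ?orbT.
Qed.

End FusionPrimes.

(** * Classification and number of the prime ideals of each type *)

Lemma card_eq_finset (T : finType) (A : {set T}) : [set` A] #= `I_#|A|.
Proof.
have -> : [set` A] = @enum_val T (mem A) @` [set: 'I_#|A|].
  apply/seteqP; split=> [x Ax|_ [i _ <-]] /=; last exact: enum_valP.
  by exists (enum_rank_in Ax x) => //; rewrite enum_rankK_in.
apply: card_eq_trans (inj_card_eq (in2W enum_val_inj)) _.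
by rewrite card_eq_sym card_II.
Qed.

Section Classification.

Variables (gT : finGroupType) (S : {group gT}) (F : fusion_system S).
Implicit Types (P Q : {group gT}) (X Y : fburnside F) (J : prime_idealr (fburnside F)).

Lemma prime_ideals_of_typeE q : char_or0 q ->
  prime_ideals_of_type (fburnside F) q = ideal_mod F ^~ q @` [set P : {group gT} | P \subset S].
Proof.
move=> q_char; apply/seteqP; split=> [I qI|_ [P PS <-]]; last first.
  exact/prime_ideals_of_type_mod.
have [J [eI _]] := qI; have [P [r [PS r_char eJ]]] := prime_ideal_eq_mod J.
move: qI; rewrite eI eJ => /(prime_ideals_of_type_mod F q PS r_char)->.
by exists P.
Qed.

Lemma ideal_mod_p p P : prime p -> p.-group S -> P \subset S ->
  ideal_mod F P p = ideal_mod F S p.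
Proof.
move=> p_pr pS PS; apply/seteqP.
by split=> X; rewrite /ideal_mod /= /fmark (mark_mod_p _ p_pr pS PS (subxx S)).
Qed.

(** For [P] and [Q] in distinct classes, the element of [fburnside_indicator] has mark 0 at [Q] and
    a power of [#|S|] at [P]. As [q] is 0 or a prime other than [p], it does not divide this
    power. *)
Lemma eq_ideal_mod p q P Q : prime p -> p.-group S -> char_or0 q -> q <> p ->
  P \subset S -> Q \subset S ->
  ideal_mod F P q = ideal_mod F Q q <-> fclass F P = fclass F Q.
Proof.
move=> p_pr pS q_char q_p PS QS; rewrite eq_fclass //; split=> [eI|PQ]; last first.
  by apply/seteqP; split=> X; rewrite /ideal_mod /= (fmark_fconj X PQ).
apply: contrapT => /negP/negPf nPQ.
have [X Xmark] := fburnside_indicator F PS.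
have /ideal_modP : ideal_mod F Q q X by rewrite /ideal_mod /= Xmark // nPQ.
move/ideal_modP; rewrite -eI => /ideal_modP.
rewrite Xmark // fconj_refl // mulr1n dvdzE /=.
case/orP: q_char => [/eqP ->|q_pr]; first by rewrite dvd0n expn_eq0 eqn0Ngt cardG_gt0.
rewrite Euclid_dvdX // => /andP[q_S _]; apply: q_p; apply/eqP.
exact: pgroupP pS q q_pr q_S.
Qed.

Lemma card_prime_ideals_of_type p q : prime p -> p.-group S -> char_or0 q -> q <> p ->
  prime_ideals_of_type (fburnside F) q #= `I_#|Cl F|.
Proof.
move=> p_pr pS q_char q_p; rewrite prime_ideals_of_typeE //.
(* An arbitrary representative is picked, as the ideal depends only on the class; classes are
   nonempty, so the default [S] is never reached on [Cl F]. *)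
pose g (C : {set {group gT}}) := ideal_mod F (odflt S [pick P in C]) q.
have gE P : P \subset S -> g (fclass F P) = ideal_mod F P q.
  move=> PS; rewrite /g; case: pickP => [Q|/(_ P)]; last first.
    by rewrite mem_fclass PS fconj_refl.
  rewrite mem_fclass => /andP[QS PQ].
  by apply/(eq_ideal_mod p_pr pS) => //; apply/esym/eq_fclass.
have ClP C : C \in Cl F -> exists2 P : {group gT}, P \subset S & C = fclass F P.
  by case/imsetP=> P; rewrite inE => PS ->; exists P.
have -> : ideal_mod F ^~ q @` [set P : {group gT} | P \subset S] = g @` [set` Cl F].
  apply/seteqP; split=> [_ [P PS <-]|_ [C /ClP[P PS ->] <-]]; last first.
    by exists P => //; rewrite gE.
  by exists (fclass F P); rewrite ?gE //=; apply: imset_f; rewrite inE.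
apply: card_eq_trans (card_eq_finset _); apply: inj_card_eq.
move=> C D; rewrite !inE => /ClP[P PS ->] /ClP[Q QS ->].
by rewrite !gE // => /(eq_ideal_mod p_pr pS q_char q_p PS QS).
Qed.

End Classification.

(** * Generators of the ideals from Reeh's basis *)

Section Generators.

Variable A : comNzRingType.
Implicit Type I : set A.

Lemma is_ideal_mulrz I x n : is_ideal I -> I x -> I (x *~ n).
Proof. by case=> _ _ mulI Ix; rewrite -mulrzl; apply: mulI. Qed.

Lemma is_ideal_sum I (T : finType) (K : pred T) (f : T -> A) :
  is_ideal I -> (forall i, K i -> I (f i)) -> I (\sum_(i | K i) f i).
Proof. by case=> I0 ID _ If; apply: big_ind. Qed.

Lemma ideal_gen_eq I (E : set A) : is_ideal I -> E `<=` I ->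
  (forall I', is_ideal I' -> E `<=` I' -> I `<=` I') -> I = ideal_gen E.
Proof.
move=> idI EI minI; apply/seteqP; split; last exact: smallest_sub.
by move=> x Ix I' [idI' EI']; apply: minI idI' EI' x Ix.
Qed.

End Generators.

Section ReehGenerators.

Variables (gT : finGroupType) (S : {group gT}) (F : fusion_system S).
Variable (alpha : {set {group gT}} -> fburnside F).
Hypothesis alphaP : reeh_basis alpha.
Implicit Types (P Q : {group gT}) (X Y : fburnside F).

Lemma is_ideal_mod P q : P \subset S -> is_ideal (ideal_mod F P q).
Proof.
move=> PS; split=> [|X Y|X Y] /=.
- by apply/ideal_modP; rewrite -[fmark P 0]/(fmark_at PS 0) rmorph0 dvdz0.
- move=> /ideal_modP dX /ideal_modP dY; apply/ideal_modP.
  by rewrite -[fmark P _]/(fmark_at PS _) rmorphD rpredD.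
- move=> /ideal_modP dY; apply/ideal_modP.
  by rewrite -[fmark P _]/(fmark_at PS _) rmorphM dvdz_mull.
Qed.

(** A nonzero mark would give an injective morphism from [S] to the smaller group [P]. *)
Lemma fmark_S_alpha P : P \proper S -> fmark S (alpha (fclass F P)) = 0.
Proof.
move=> PS; apply/eqP/negPn; rewrite (reeh_mark_neq0 alphaP) ?(proper_sub PS) //.
by apply/negP=> /flesssim_card; rewrite leqNgt proper_card.
Qed.

Lemma Cl_cases C : C \in Cl F ->
  C = fclass F S \/ exists2 P : {group gT}, P \proper S & C = fclass F P.
Proof.
case/imsetP=> P; rewrite inE => PS ->.
have [SP|nSP] := boolP (S \subset P).
  by left; congr (fclass F _); apply/group_inj/eqP; rewrite finset.eqEsubset PS.
by right; exists P; rewrite // properE PS.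
Qed.

(** The mark at [S] kills every basis element except the unit, so it reads off the coefficient of
    [alpha (fclass F S)]. This coefficient is divisible by [p], and the other terms are multiples of
    generators. *)
Lemma ideal_mod_gen (p : nat) :
  ideal_mod F S p =
    ideal_gen ([set alpha (fclass F P) | P in [set P : {group gT} | P \proper S]]
               `|` [set alpha (fclass F S) *+ p]).
Proof.
apply: ideal_gen_eq; first exact: is_ideal_mod.
  move=> _ [[P PS <-]|->]; apply/ideal_modP; first by rewrite fmark_S_alpha ?dvdz0.
  by rewrite (reeh_unit alphaP) -[fmark S _]/(fmark_at (subxx S) _) rmorph_nat natz.
move=> I idI EI X /ideal_modP; have [c ->] := reeh_generates alphaP X.
have SCl : fclass F S \in Cl F by apply: imset_f; rewrite inE.
rewrite (bigD1 (fclass F S)) //=; set Y := \sum_(C in _ | _) _.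
have propI C : (C \in Cl F) && (C != fclass F S) -> I (alpha C) /\ fmark S (alpha C) = 0.
  case/andP=> /Cl_cases[->|[P PS ->] _]; first by rewrite eqxx.
  by split; [apply: EI; left; exists P | apply: fmark_S_alpha].
have IY : I Y by apply: is_ideal_sum => // C /propI[IC _]; apply: is_ideal_mulrz.
rewrite -[fmark S _]/(fmark_at (subxx S) _) rmorphD /= rmorph_sum big1 => [|C]; last first.
  by case/propI=> _ aC0; rewrite rmorphMz /= [fmark_at _ _]aC0 mul0rz.
rewrite addr0 (reeh_unit alphaP) rmorph_int intz => /dvdzP[k ->].
have [_ ID _] := idI; apply: ID => //; rewrite mulrC mulrzA.
apply: is_ideal_mulrz => //; apply: EI; right.
by rewrite (reeh_unit alphaP).
Qed.

(** If [X] has mark 0 at [P], replacing each basis element by its difference with its own mark at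
    [P] changes the expansion by [fmark P X], that is, not at all. The term of the class of [S]
    becomes 0. *)
Lemma ideal0_gen P : P \subset S ->
  ideal0 F P =
    ideal_gen [set alpha (fclass F Q) - alpha (fclass F S) *~ fmark P (alpha (fclass F Q))
              | Q in [set Q : {group gT} | Q \proper S]].
Proof.
move=> PS; apply: ideal_gen_eq; first by rewrite -ideal_mod0; apply: is_ideal_mod.
  move=> _ [Q QS <-]; rewrite /ideal0 /= (reeh_unit alphaP) -[fmark P _]/(fmark_at PS _).
  by rewrite rmorphB rmorph_int intz subrr.
move=> I idI EI X; rewrite /ideal0 /=; have [c ->] := reeh_generates alphaP X => markX.
have -> : \sum_(C in Cl F) alpha C *~ c C =
    \sum_(C in Cl F) (alpha C - (fmark P (alpha C))%:~R) *~ c C.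
  have sum0 : \sum_(C in Cl F) fmark P (alpha C) * c C = 0.
    rewrite -[RHS]markX -[RHS]/(fmark_at PS _) rmorph_sum; apply: eq_bigr => C _.
    by rewrite rmorphMz /= mulrzz.
  rewrite -[LHS]subr0 -[X in _ - X](mulr0z 1) -{1}sum0 rmorph_sum -sumrB.
  by apply: eq_bigr => C _; rewrite mulrzBl /= intrM mulrzr.
apply: is_ideal_sum => // C /Cl_cases[->|[Q QS ->]]; apply: is_ideal_mulrz => //.
  rewrite (reeh_unit alphaP) -[fmark P _]/(fmark_at PS _) rmorph1 subrr.
  by case: idI.
by apply: EI; exists Q; rewrite ?(reeh_unit alphaP).
Qed.

End ReehGenerators.

Theorem theorem2p3 (gT : finGroupType) (S : {group gT}) (p : nat)
    (F : fusion_system S) (p_prime : prime p) (pS : (p.-group S)%g)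
    (satF : saturated F p) :
  let proper_subgroups_S := [set P : {group gT} | P \proper S] in
  let subgroups_S := [set P : {group gT} | P \subset S] in
  [/\ (* every prime ideal has type 0 or a prime type *)
      forall J : prime_idealr (fburnside F),
        exists q : nat, prime_ideals_of_type (fburnside F) q [set` (J : {pred fburnside F})],
      (* type p *)
      prime_ideals_of_type (fburnside F) p = [set ideal_mod F S p] /\
      (forall alpha, reeh_basis alpha ->
         ideal_mod F S p =
           ideal_gen ([set alpha (fclass F P) | P in proper_subgroups_S]
                      `|` [set alpha (fclass F S) *+ p])),
      (* type 0 *)
      [/\ prime_ideals_of_type (fburnside F) 0 = [set ideal0 F P | P in subgroups_S],
          prime_ideals_of_type (fburnside F) 0 #= `I_#|Cl F|,
          forall P Q : {group gT}, P \subset S -> Q \subset S ->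
            (ideal0 F P = ideal0 F Q <-> fclass F P = fclass F Q)
        & forall alpha, reeh_basis alpha ->
            forall P : {group gT}, P \subset S ->
              ideal0 F P =
                ideal_gen [set alpha (fclass F Q)
                               - alpha (fclass F S)
                                   *~ fmark P (alpha (fclass F Q))
                          | Q in proper_subgroups_S]]
    & (* type q, for each prime q <> p *)
      forall q : nat, prime q -> q <> p ->
      [/\ prime_ideals_of_type (fburnside F) q = [set ideal_mod F P q | P in subgroups_S],
          prime_ideals_of_type (fburnside F) q #= `I_#|Cl F|
        & forall P Q : {group gT}, P \subset S -> Q \subset S ->
            (ideal_mod F P q = ideal_mod F Q q <-> fclass F P = fclass F Q)]].
Proof.
have type0 : char_or0 0 by [].
have p0 : 0%N <> p by move=> p0; move: p_prime; rewrite -p0.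
(* Divisibility by 0 means vanishing, so type 0 is the case [q = 0] of the common classification. *)
have mod0 : ideal_mod F ^~ 0%N = ideal0 F by apply/funext=> P; rewrite ideal_mod0.
split.
- move=> J; have [P [q [PS q_char ->]]] := prime_ideal_eq_mod J.
  by exists q; apply/prime_ideals_of_type_mod.
- split; last by move=> alpha alphaP; apply: ideal_mod_gen.
  rewrite prime_ideals_of_typeE; last by rewrite /char_or0 p_prime orbT.
  (* All marks agree modulo [p], so the ideals of all subgroups collapse to that of [S]. *)
  apply/seteqP; split=> [_ [P PS <-]|_ ->]; first exact: (ideal_mod_p F p_prime pS).
  by exists S => //=; apply: subxx.
- split.
  + by rewrite prime_ideals_of_typeE // mod0.
  + exact: card_prime_ideals_of_type p_prime pS type0 p0.
  + by move=> P Q PS QS; rewrite -!ideal_mod0; apply: eq_ideal_mod p_prime pS _ _ _ _.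
  + by move=> alpha alphaP P; apply: ideal0_gen.
move=> q q_pr q_p; have q_char : char_or0 q by rewrite /char_or0 q_pr orbT.
split; first exact: prime_ideals_of_typeE.
  exact: card_prime_ideals_of_type p_prime pS q_char q_p.
by move=> P Q PS QS; apply: eq_ideal_mod p_prime pS q_char q_p PS QS.
Qed.
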